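(* Let $a<b$, $c<d$. Suppose $N\in\mathcal N_{2D}^{n\times m}$ and define $\hat N\in\mathcal N_{2D}^{m\times n}$ by $$\begin{bmatrix}\hat N_{00}(x,y)&\hat N_{01}(x,y,\nu)&\hat N_{02}(x,y,\nu)\\\hat N_{10}(x,y,\theta)&\hat N_{11}(x,y,\theta,\nu)&\hat N_{12}(x,y,\theta,\nu)\\\hat N_{20}(x,y,\theta)&\hat N_{21}(x,y,\theta,\nu)&\hat N_{22}(x,y,\theta,\nu)\end{bmatrix}=\begin{bmatrix}N_{00}^T(x,y)&N_{02}^T(x,\nu,y)&N_{01}^T(x,\nu,y)\\N_{20}^T(\theta,y,x)&N_{22}^T(\theta,\nu,x,y)&N_{21}^T(\theta,\nu,x,y)\\N_{10}^T(\theta,y,x)&N_{12}^T(\theta,\nu,x,y)&N_{11}^T(\theta,\nu,x,y)\end{bmatrix}.$$ Then for any $u\in L_2^m([a,b]\times[c,d])$ and $v\in L_2^n([a,b]\times[c,d])$, $$\langle v,\mathcal P[N]u\rangle_{L_2}=\langle\mathcal P[\hat N]v,u\rangle_{L_2}.$$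
   Context: $\mathcal N_{2D}^{n\times m}$ is the set of $3\times3$ arrays $(N_{ij})_{i,j\in\{0,1,2\}}$ of $\mathbb R^{n\times m}$-valued $L_2$ functions: $N_{00}\in L_2^{n\times m}[x,y]$; $N_{01},N_{02}\in L_2^{n\times m}[x,y,\nu]$; $N_{10},N_{20}\in L_2^{n\times m}[x,y,\theta]$; $N_{11},N_{12},N_{21},N_{22}\in L_2^{n\times m}[x,y,\theta,\nu]$, with $x,\theta\in[a,b]$, $y,\nu\in[c,d]$. The associated 2D-PI operator $\mathcal P[N]:L_2^m([a,b]\times[c,d])\to L_2^n([a,b]\times[c,d])$ is $$\begin{aligned}(\mathcal P[N]u)(x,y)=\;&N_{00}(x,y)u(x,y)+\int_a^xN_{10}(x,y,\theta)u(\theta,y)d\theta+\int_x^bN_{20}(x,y,\theta)u(\theta,y)d\theta\\&+\int_c^yN_{01}(x,y,\nu)u(x,\nu)d\nu+\int_y^dN_{02}(x,y,\nu)u(x,\nu)d\nu\\&+\int_a^x\!\!\int_c^yN_{11}(x,y,\theta,\nu)u(\theta,\nu)d\nu d\theta+\int_x^b\!\!\int_c^yN_{21}(x,y,\theta,\nu)u(\theta,\nu)d\nu d\theta\\&+\int_a^x\!\!\int_y^dN_{12}(x,y,\theta,\nu)u(\theta,\nu)d\nu d\theta+\int_x^b\!\!\int_y^dN_{22}(x,y,\theta,\nu)u(\theta,\nu)d\nu d\theta.\end{aligned}$$ $\langle\cdot,\cdot\rangle_{L_2}$ is the standard inner product of vector-valued $L_2$ functions on $[a,b]\times[c,d]$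.
   Formalization: Since an N with merely L_2 entries need not map L_2 to L_2 (e.g. unbounded N_00), the declared property P[N]: L_2^m → L_2^n is taken as a hypothesis on N; that N̂ lies in N_2D and that P[N̂] maps L_2^n to L_2^m is part of the conclusion. *)

(* Defs.v *)
From HB Require Import structures.
From mathcomp Require Import all_boot all_order all_algebra.
From mathcomp Require Import all_classical all_reals all_analysis.

Set Implicit Arguments.
Unset Strict Implicit.
Unset Printing Implicit Defensive.
Import Order.TTheory GRing.Theory Num.Theory.
Import numFieldNormedType.Exports.

Local Open Scope classical_set_scope.
Local Open Scope ring_scope.

(* Elements of L_2 are represented by Borel functions
   (no quotient by almost-everywhere equality).  A function given on the whole
   space stands for its restriction to [D]: [f \_ D] is [f] on [D], 0 outside. *)
Definition in_L2 (d : measure_display) (T : measurableType d) (R : realType)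
    (mu : {measure set T -> \bar R}) (D : set T) (n m : nat)
    (f : T -> 'M[R]_(n, m)) : Prop :=
  forall i j, (fun z => f z i j) \_ D \in Lfun mu 2%:E.

Section PI2D.
Variable R : realType.

Local Notation leb := (@lebesgue_measure R).

Definition leb2 : {measure set (measurableTypeR R * measurableTypeR R) -> \bar R} :=
  (leb \x leb)%E.
Definition leb3 : {measure set (measurableTypeR R * measurableTypeR R
    * measurableTypeR R) -> \bar R} := (leb \x leb \x leb)%E.
Definition leb4 : {measure set (measurableTypeR R * measurableTypeR R
    * measurableTypeR R * measurableTypeR R) -> \bar R} :=
  (leb \x leb \x leb \x leb)%E.

Definition box (a b c d : R) : set (R * R) := `[a, b] `*` `[c, d].

Definition L2_box (a b c d : R) (n : nat) (u : R * R -> 'cV[R]_n) : Prop :=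
  in_L2 leb2 (box a b c d) u.

Definition inner_L2 (a b c d : R) (n : nat) (u v : R * R -> 'cV[R]_n) : R :=
  \int[leb2]_(z in box a b c d) (\sum_(i < n) u z i 0 * v z i 0).

Definition vint (n : nat) (D : set R) (f : R -> 'cV[R]_n) : 'cV[R]_n :=
  \col_i \int[leb]_(t in D) f t i 0.

(* The arguments of the entries come in the order x, y, theta, nu, with the
   ones an entry does not depend on left out. *)
Record PIparam (n m : nat) := MkPIparam {
  N00 : R * R -> 'M[R]_(n, m);
  N01 : R * R * R -> 'M[R]_(n, m);
  N02 : R * R * R -> 'M[R]_(n, m);
  N10 : R * R * R -> 'M[R]_(n, m);
  N11 : R * R * R * R -> 'M[R]_(n, m);
  N12 : R * R * R * R -> 'M[R]_(n, m);
  N20 : R * R * R -> 'M[R]_(n, m);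
  N21 : R * R * R * R -> 'M[R]_(n, m);
  N22 : R * R * R * R -> 'M[R]_(n, m) }.

Definition in_N2D (a b c d : R) (n m : nat) (N : PIparam n m) : Prop :=
  let Dxyt := box a b c d `*` `[a, b] in
  let Dxyn := box a b c d `*` `[c, d] in
  let Dxytn := Dxyt `*` `[c, d] in
  [/\ in_L2 leb2 (box a b c d) (N00 N),
      in_L2 leb3 Dxyn (N01 N) /\ in_L2 leb3 Dxyn (N02 N),
      in_L2 leb3 Dxyt (N10 N) /\ in_L2 leb3 Dxyt (N20 N),
      in_L2 leb4 Dxytn (N11 N) /\ in_L2 leb4 Dxytn (N12 N) &
      in_L2 leb4 Dxytn (N21 N) /\ in_L2 leb4 Dxytn (N22 N)].

Definition PI_op (a b c d : R) (n m : nat) (N : PIparam n m)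
    (u : R * R -> 'cV[R]_m) (z : R * R) : 'cV[R]_n :=
  let: (x, y) := z in
  N00 N (x, y) *m u (x, y)
  + vint `[a, x] (fun t => N10 N (x, y, t) *m u (t, y))
  + vint `[x, b] (fun t => N20 N (x, y, t) *m u (t, y))
  + vint `[c, y] (fun s => N01 N (x, y, s) *m u (x, s))
  + vint `[y, d] (fun s => N02 N (x, y, s) *m u (x, s))
  + vint `[a, x] (fun t =>
      vint `[c, y] (fun s => N11 N (x, y, t, s) *m u (t, s)))
  + vint `[x, b] (fun t =>
      vint `[c, y] (fun s => N21 N (x, y, t, s) *m u (t, s)))
  + vint `[a, x] (fun t =>
      vint `[y, d] (fun s => N12 N (x, y, t, s) *m u (t, s)))
  + vint `[x, b] (fun t =>
      vint `[y, d] (fun s => N22 N (x, y, t, s) *m u (t, s))).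

(* The operator sends L_2^m to L_2^n.  This is not automatic for N in N_2D:
   with N00 and u merely square integrable, N00 u need only be integrable. *)
Definition PI_op_L2 (a b c d : R) (n m : nat) (N : PIparam n m) : Prop :=
  forall u : R * R -> 'cV[R]_m,
    L2_box a b c d u -> L2_box a b c d (PI_op a b c d N u).

Definition PIadj (n m : nat) (N : PIparam n m) : PIparam m n := {|
  N00 := fun '(x, y) => (N00 N (x, y))^T;
  N01 := fun '(x, y, s) => (N02 N (x, s, y))^T;
  N02 := fun '(x, y, s) => (N01 N (x, s, y))^T;
  N10 := fun '(x, y, t) => (N20 N (t, y, x))^T;
  N11 := fun '(x, y, t, s) => (N22 N (t, s, x, y))^T;
  N12 := fun '(x, y, t, s) => (N21 N (t, s, x, y))^T;
  N20 := fun '(x, y, t) => (N10 N (t, y, x))^T;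
  N21 := fun '(x, y, t, s) => (N12 N (t, s, x, y))^T;
  N22 := fun '(x, y, t, s) => (N11 N (t, s, x, y))^T |}.

End PI2D.

(* Main.v *)
From HB Require Import structures.
Require Import Defs.
From mathcomp Require Import all_boot all_order all_algebra.
From mathcomp Require Import all_classical all_reals all_analysis.
From mathcomp Require Import measurable_realfun ring lra.
Set Implicit Arguments.
Unset Strict Implicit.
Unset Printing Implicit Defensive.
Import Order.TTheory GRing.Theory Num.Theory.
Import numFieldNormedType.Exports.
Local Open Scope classical_set_scope.
Local Open Scope ring_scope.

(* For kernels that are only square integrable, the integrand of <v, P[N]u> need
   not be integrable in all variables, so Fubini does not apply directly.  It does
   when v is supported in E_k, the set where the partial L2 norms of the kernels
   in their integrated variables are at most k; there u |-> <v, P[N]u> is also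
   bounded.  Since P[N] maps L2 to L2, the functionals u |-> <v 1_{E_k}, P[N]u>
   are pointwise bounded in k, and the uniform boundedness principle gives
   |<v, P[N]u>| <= C |u|.  The same truncation for the adjoint kernel yields
   <v, P[N]u> = <P[N^]v, u> for u supported in F_k: taking u a truncation of
   P[N^]v shows that P[N^]v is in L2, and taking u 1_{F_k} -> u gives the identity
   for all u. *)

(** * Square integrable functions *)

(** [PI_op_L2] is a statement about the sum of all nine terms on vectors and says nothing about a
    single term. So [adjoint_pair] is built to be closed under sums, by intersecting the exhausting
    sets, and the mapping property enters only after the nine terms have been added. It reaches the
    scalar operator in entry (i, j) by applying P[N] to vectors with one nonzero component. The
    partial integrals of a square integrable kernel converge only at almost every point, and
    [Rintegral] returns 0 where an integral is not finite. Hence linearity, and the splitting of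
    P[N] into its entries, are stated almost everywhere. Functions are not identified when they
    agree almost everywhere, so L2 is a seminormed space. A gliding hump suits this setting: its
    only completeness input is the sum of one geometric series of functions. *)

Section square_integrable.
Context d (T : measurableType d) (R : realType).
Variable mu : {measure set T -> \bar R}.

Definition L2 (f : T -> R) : Prop :=
  measurable_fun setT f /\ mu.-integrable setT (EFin \o (fun x => f x ^+ 2)).

Definition sqnorm (f : T -> R) : R := \int[mu]_x (f x ^+ 2).

Implicit Types f g h : T -> R.

Lemma integrable_le f g : measurable_fun setT f ->
  (forall x, `|f x| <= g x) -> mu.-integrable setT (EFin \o g) ->
  mu.-integrable setT (EFin \o f).
Proof.
move=> mf fg; apply: le_integrable => //; first exact/measurable_EFinP.
by move=> x _ /=; rewrite lee_fin (le_trans (fg x))// ler_norm.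
Qed.

Lemma integrable_add f g : mu.-integrable setT (EFin \o f) ->
  mu.-integrable setT (EFin \o g) ->
  mu.-integrable setT (EFin \o (fun x => f x + g x)).
Proof. by move=> If Ig; have := integrableD measurableT If Ig. Qed.

Lemma integrable_scale k f : mu.-integrable setT (EFin \o f) ->
  mu.-integrable setT (EFin \o (fun x => k * f x)).
Proof. by move=> If; have := integrableZl measurableT k If. Qed.

Lemma Rintegral_sum (I : Type) (r : seq I) (P : pred I) (F : I -> T -> R) :
  (forall i, P i -> mu.-integrable setT (EFin \o F i)) ->
  mu.-integrable setT (EFin \o (fun x => \sum_(i <- r | P i) F i x)) /\
  \int[mu]_x (\sum_(i <- r | P i) F i x) = \sum_(i <- r | P i) \int[mu]_x F i x.
Proof.
move=> IF; elim: r => [|i r [IH1 IH2]].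
  rewrite big_nil (_ : (fun _ => _) = (fun=> 0)); last first.
    by apply/funext => x; rewrite big_nil.
  by split; [exact: integrable0|rewrite Rintegral_cst// mul0r].
rewrite big_cons (_ : (fun x => \sum_(i <- _ | P i) _) =
    (fun x => (if P i then F i x else 0) + \sum_(i <- r | P i) F i x)); last first.
  by apply/funext => x; rewrite big_cons; case: ifP => //; rewrite add0r.
case: ifPn => Pi; last first.
  by under eq_fun do rewrite add0r.
have IFi := IF _ Pi.
by split; [exact: integrable_add|rewrite RintegralD// IH2].
Qed.

Lemma L2_mul f g : L2 f -> L2 g ->
  mu.-integrable setT (EFin \o (fun x => f x * g x)).
Proof.
move=> [mf If] [mg Ig]; apply: (integrable_le _ _ (integrable_add If Ig)).
  exact: measurable_funM.
move=> x; rewrite normrM -(real_normK (num_real (f x))).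
rewrite -(real_normK (num_real (g x))).
have := normr_ge0 (f x); have := normr_ge0 (g x); nra.
Qed.

Lemma L2_le f g : measurable_fun setT f ->
  (forall x, `|f x| <= `|g x|) -> L2 g -> L2 f.
Proof.
move=> mf fg [mg Ig]; split=> //; apply: integrable_le Ig.
  exact: measurable_funX.
move=> x; rewrite normrX -(real_normK (num_real (g x))).
by rewrite lerXn2r ?nnegrE// normr_ge0.
Qed.

Lemma L2_add f g : L2 f -> L2 g -> L2 (fun x => f x + g x).
Proof.
move=> [mf If] [mg Ig]; split; first exact: measurable_funD.
apply: (integrable_le _ _ (integrable_add (integrable_scale 2 If)
  (integrable_scale 2 Ig))).
  by apply: measurable_funX; exact: measurable_funD.
by move=> x; rewrite ger0_norm ?sqr_ge0//; have := sqr_ge0 (f x - g x); nra.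
Qed.

Lemma L2_scale k f : L2 f -> L2 (fun x => k * f x).
Proof.
move=> [mf If]; split; first exact: measurable_funM.
rewrite (_ : _ \o _ = EFin \o (fun x => k ^+ 2 * f x ^+ 2)).
  exact: integrable_scale.
by apply/funext => x /=; rewrite exprMn.
Qed.

Lemma L2_0 : L2 (fun=> 0).
Proof.
split; first exact: measurable_cst.
rewrite (_ : _ \o _ = cst 0%E); first exact: integrable0.
by apply/funext => x /=; rewrite expr0n.
Qed.

Lemma L2_sub f g : L2 f -> L2 g -> L2 (fun x => f x - g x).
Proof.
move=> Lf Lg; rewrite [X in L2 X](_ : _ = fun x => f x + -1 * g x).
  by apply: L2_add => //; exact: L2_scale.
by apply/funext => x; rewrite mulN1r.
Qed.

Lemma L2_sum (I : Type) (r : seq I) (P : pred I) (F : I -> T -> R) :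
  (forall i, P i -> L2 (F i)) -> L2 (fun x => \sum_(i <- r | P i) F i x).
Proof.
move=> LF; elim: r => [|i r IH].
  rewrite [X in L2 X](_ : _ = fun=> 0); first exact: L2_0.
  by apply/funext => x; rewrite big_nil.
rewrite [X in L2 X](_ : _ = fun x =>
    (if P i then F i else fun=> 0) x + \sum_(i <- r | P i) F i x).
  by apply: L2_add => //; case: ifP => Pi; [exact: LF|exact: L2_0].
by apply/funext => x; rewrite big_cons; case: ifP => //; rewrite add0r.
Qed.

Lemma L2_indic f (E : set T) : measurable E -> L2 f -> L2 (fun x => f x * \1_E x).
Proof.
move=> mE [mf If]; apply: (L2_le _ _ (conj mf If)).
  by apply: measurable_funM => //; exact: measurable_indic.
by move=> x; rewrite indicE; case: (x \in E); rewrite /= ?mulr1// mulr0 normr0.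
Qed.

Lemma L2P f : measurable_fun setT f ->
  (\int[mu]_x ((f x ^+ 2)%:E) < +oo)%E -> L2 f.
Proof.
move=> mf fi; split=> //; apply/integrableP; split.
  by apply/measurable_EFinP; exact: measurable_funX.
under eq_integral do rewrite /= ger0_norm ?sqr_ge0//.
exact: fi.
Qed.

Lemma sqnormE f : L2 f -> (sqnorm f)%:E = (\int[mu]_x ((f x ^+ 2)%:E))%E.
Proof. by move=> [mf If]; rewrite /sqnorm /Rintegral fineK// integrable_fin_num. Qed.

Lemma sqnorm_ge0 f : 0 <= sqnorm f.
Proof. by apply: Rintegral_ge0 => x _; exact: sqr_ge0. Qed.

Lemma sqnormZ k f : L2 f -> sqnorm (fun x => k * f x) = k ^+ 2 * sqnorm f.
Proof.
move=> [mf If]; rewrite /sqnorm -RintegralZl//.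
by apply: eq_Rintegral => x _; rewrite exprMn.
Qed.

Lemma cauchy_schwarz f g : L2 f -> L2 g ->
  (\int[mu]_x (f x * g x)) ^+ 2 <= sqnorm f * sqnorm g.
Proof.
move=> Lf Lg; have [mf If] := Lf; have [mg Ig] := Lg.
have Ifg := L2_mul Lf Lg.
set H := \int[mu]_x (f x * g x).
(* This is the integral of (f + t g)^2; the values of t chosen below replace the discriminant. *)
have quad t : 0 <= sqnorm f + 2 * t * H + t ^+ 2 * sqnorm g.
  rewrite /sqnorm /H -RintegralZl// -RintegralZl// -RintegralD//; last first.
    exact: integrable_scale.
  rewrite -RintegralD//; last 2 first.
  - by apply: integrable_add => //; exact: integrable_scale.
  - exact: integrable_scale.
  by apply: Rintegral_ge0 => x _; have := sqr_ge0 (f x + t * g x); nra.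
have := sqnorm_ge0 f; have := sqnorm_ge0 g.
set F := sqnorm f in quad *; set G := sqnorm g in quad * => G0 F0.
have [G0'|Gn0] := eqVneq G 0; last first.
  have Gp : 0 < G by rewrite lt_neqAle eq_sym Gn0.
  have := quad (- H / G).
  rewrite (_ : F + _ + _ = F - H ^+ 2 / G); last by field.
  by rewrite subr_ge0 ler_pdivrMr.
have [->|Hn0] := eqVneq H 0; first by rewrite expr0n mulr_ge0.
(* With G = 0 the expression is affine in t with slope 2 H; this t gives it the value -1. *)
have := quad (- (F + 1) / (2 * H)).
rewrite G0' mulr0 addr0 (_ : F + _ = -1); last by field.
by rewrite leNgt ltrN10.
Qed.

End square_integrable.

(** * Almost everywhere limits and series in L2 *)

Section completeness.
Context d (T : measurableType d) (R : realType).
Variable mu : {measure set T -> \bar R}.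

Lemma cvgn_EFin (u : R^nat) (l : R) :
  u @ \oo --> l -> (fun n => (u n)%:E) @ \oo --> l%:E.
Proof. by move=> ul; apply/fine_cvgP; split => //; exact: nearW. Qed.

Lemma limn_einf_le (u : (\bar R)^nat) (C : \bar R) :
  (forall n, (u n <= C)%E) -> (limn_einf u <= C)%E.
Proof.
move=> uC; rewrite limn_einf_lim; apply: lime_le; first exact: is_cvg_einfs.
by near=> n; apply: le_trans (uC n); apply: ereal_inf_lbound; exists n => /=.
Unshelve. all: by end_near. Qed.

(** Fatou's lemma for the squares. It serves twice: for the sum of the geometric series, and to
    recover A' v from its truncations. *)
Lemma L2_ae_limit (s : nat -> T -> R) (y : T -> R) (C : R) :
  (forall n, L2 mu (s n)) -> (forall n, sqnorm mu (s n) <= C) ->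
  measurable_fun setT y -> {ae mu, forall z, s ^~ z @ \oo --> y z} ->
  L2 mu y /\ sqnorm mu y <= C.
Proof.
move=> Ls sC my sy.
pose F n z : \bar R := (s n z ^+ 2)%:E.
have mF n : measurable_fun setT (F n).
  by apply/measurable_EFinP; apply: measurable_funX; have [] := Ls n.
have F0 n z : setT z -> (0 <= F n z)%E by rewrite lee_fin sqr_ge0.
have yC : (\int[mu]_z ((y z ^+ 2)%:E) <= C%:E)%E.
  apply: (@le_trans _ _ (\int[mu]_z (limn_einf (F ^~ z)))%E).
    apply: ae_ge0_le_integral => //.
    - by move=> z _; rewrite lee_fin sqr_ge0.
    - by apply/measurable_EFinP; exact: measurable_funX.
    - move=> z _; rewrite limn_einf_lim; apply: lime_ge; first exact: is_cvg_einfs.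
      by near=> n; apply: le_ereal_inf_tmp => _ [k _ <-]; exact: F0.
    - rewrite /limn_einf; apply: measurableT_comp => //.
      apply: measurable_fun_limn_esup => n; exact: measurableT_comp.
    apply: filterS sy => z syz _.
    suff /cvg_limn_einf_sup[-> _] : F ^~ z @ \oo --> (y z ^+ 2)%:E by [].
    by apply: cvgn_EFin; exact: cvgM.
  apply: (le_trans (@fatou _ _ _ mu setT measurableT F mF F0)).
  by apply: limn_einf_le => n; rewrite -sqnormE// lee_fin.
have Ly : L2 mu y by apply: L2P => //; exact: le_lt_trans yC (ltry _).
by split=> //; rewrite -lee_fin sqnormE.
Unshelve. all: by end_near. Qed.

(** Weighted Cauchy-Schwarz for finite sums. Used pointwise under the integral, it bounds the norm
    of a partial sum by the norms of its terms. *)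
Lemma sqr_sum_le (n m : nat) (w x : nat -> R) : (forall i, 0 <= w i) ->
  (\sum_(n <= i < m) w i * x i) ^+ 2 <=
  (\sum_(n <= i < m) w i) * \sum_(n <= i < m) w i * x i ^+ 2.
Proof.
move=> w0; elim: m => [|m IH]; first by rewrite !big_geq// expr0n mulr0.
have [nm|mn] := leqP n m; last by rewrite !big_geq// expr0n mulr0.
rewrite !big_nat_recr//=.
have : 0 <= \sum_(n <= i < m) w i by apply: sumr_ge0.
have : 0 <= \sum_(n <= i < m) w i * x i ^+ 2.
  by apply: sumr_ge0 => i _; rewrite mulr_ge0 ?sqr_ge0.
have := w0 m; move: IH (w m) (x m).
set A := \sum_(n <= i < m) w i * x i; set B := \sum_(n <= i < m) w i * x i ^+ 2.
set W := \sum_(n <= i < m) w i => AWB v a v0 B0 W0.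
(* After expansion the induction step is v times this inequality, which follows from A^2 <= W B and
   the inequality between arithmetic and geometric means. *)
suff : 2 * (A * a) <= W * a ^+ 2 + B by nra.
have [|neg] := lerP (A * a) 0.
  have : 0 <= W * a ^+ 2 by rewrite mulr_ge0 ?sqr_ge0.
  lra.
have P0 : 0 <= W * a ^+ 2 + B by rewrite addr_ge0// mulr_ge0 ?sqr_ge0.
rewrite -(@ler_pXn2r _ 2)// ?nnegrE//; last by rewrite mulr_ge0// ltW.
have : A ^+ 2 * a ^+ 2 <= W * B * a ^+ 2 by rewrite ler_wpM2r ?sqr_ge0.
by have := sqr_ge0 (W * a ^+ 2 - B); nra.
Qed.

(** With ratio 1/3 the terms after the j-th sum to at most q^j / 2, less than the share 3/4 q^j that
    the j-th term is made to contribute in the gliding hump. *)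
Let q : R := 3^-1.
Let q0 : 0 <= q. Proof. by rewrite invr_ge0. Qed.

Lemma sum_geometric3_le n m : \sum_(n <= i < m) q ^+ i <= 3 / 2 * q ^+ n.
Proof.
have [nm|mn] := leqP n m; last first.
  by rewrite big_geq 1?ltnW// mulr_ge0// exprn_ge0.
suff -> : \sum_(n <= i < m) q ^+ i = 3 / 2 * (q ^+ n - q ^+ m).
  by rewrite ler_pM2l// gerBl exprn_ge0.
rewrite -(subnKC nm); elim: (m - n)%N => [|k IH].
  by rewrite addn0 big_geq// subrr mulr0.
rewrite addnS big_nat_recr/= ?leq_addr// IH exprS.
by rewrite /q; field.
Qed.

(** [sqr_sum_le] with weights q^i bounds the differences of partial sums, and Fatou carries the
    bound to the limit. *)
Lemma L2_geometric_series (x : nat -> T -> R) :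
  (forall i, L2 mu (x i)) -> (forall i, sqnorm mu (x i) <= 1) ->
  exists2 y, L2 mu y & forall n,
    sqnorm mu (fun z => y z - \sum_(0 <= i < n) q ^+ i * x i z) <=
    (3 / 2 * q ^+ n) ^+ 2.
Proof.
move=> Lx x1.
pose s n z := \sum_(0 <= i < n) q ^+ i * x i z.
have Ls n : L2 mu (s n) by apply: L2_sum => i _; exact: L2_scale.
have cauchy n m : sqnorm mu (fun z => s (m + n)%N z - s n z) <=
    (3 / 2 * q ^+ n) ^+ 2.
  have sE z : s (m + n)%N z - s n z = \sum_(n <= i < m + n) q ^+ i * x i z.
    by rewrite /s (@big_cat_nat _ _ _ n 0 (m + n))//= ?leq_addl// addrAC subrr add0r.
  pose g i z := q ^+ i * x i z ^+ 2.
  have Ig i : mu.-integrable setT (EFin \o g i).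
    by apply: integrable_scale; have [] := Lx i.
  have [Isum sumE] := @Rintegral_sum _ _ _ mu _
    (index_iota n (m + n)) xpredT g (fun i _ => Ig i).
  have gE i : \int[mu]_z g i z = q ^+ i * sqnorm mu (x i).
    by rewrite /g RintegralZl//; have [] := Lx i.
  set W := \sum_(n <= i < m + n) q ^+ i.
  have W0 : 0 <= W by apply: sumr_ge0 => i _; exact: exprn_ge0.
  apply: (@le_trans _ _ (W * W)); last first.
    by rewrite -expr2 lerXn2r ?nnegrE ?sum_geometric3_le// mulr_ge0// exprn_ge0.
  have SW : \int[mu]_z (\sum_(n <= i < m + n) g i z) <= W.
    rewrite sumE; apply: ler_sum => i _.
    by rewrite gE ler_piMr// exprn_ge0.
  apply: (@le_trans _ _ (W * \int[mu]_z (\sum_(n <= i < m + n) g i z))); last first.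
    by rewrite ler_wpM2l.
  rewrite -RintegralZl//; apply: le_Rintegral => //.
  - by have [] := L2_sub (Ls (m + n)%N) (Ls n).
  - exact: integrable_scale.
  - by move=> z _; rewrite sE; apply: sqr_sum_le => i; exact: exprn_ge0.
(* The integral of [G] is at most 3/2, so [G] is finite almost everywhere; there the series
   converges absolutely, since |x| <= 1 + x^2. *)
pose G z : \bar R := (\sum_(i <oo) (q ^+ i * x i z ^+ 2)%:E)%E.
have term0 i z : (0 <= (q ^+ i * x i z ^+ 2)%:E)%E.
  by rewrite lee_fin mulr_ge0 ?sqr_ge0// exprn_ge0.
have mterm i : measurable_fun setT (fun z => (q ^+ i * x i z ^+ 2)%:E).
  by apply/measurable_EFinP; apply: measurable_funM => //;
    apply: measurable_funX; have [] := Lx i.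
have G0 z : (0 <= G z)%E by apply: nneseries_ge0 => i _ _; exact: term0.
have IG : mu.-integrable setT G.
  apply/integrableP; split;
    first by apply: ge0_emeasurable_sum => // i z _ _; exact: term0.
  under eq_integral do rewrite gee0_abs//.
  rewrite integral_nneseries//.
  apply: (@le_lt_trans _ _ (3 / 2)%:E); last exact: ltry.
  apply: lime_le; first by apply: is_cvg_nneseries => i _ _; exact: integral_ge0.
  near=> n; apply: (@le_trans _ _ (\sum_(0 <= i < n) q ^+ i)%:E); last first.
    by rewrite lee_fin (le_trans (sum_geometric3_le _ _))// expr0 mulr1.
  rewrite -sumEFin; apply: lee_sum => i _.
  under eq_integral do rewrite EFinM.
  rewrite ge0_integralZl_EFin//; last 3 first.
  - by move=> z _; rewrite lee_fin sqr_ge0.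
  - by apply/measurable_EFinP; apply: measurable_funX; have [] := Lx i.
  - exact: exprn_ge0.
  by rewrite -sqnormE// -EFinM lee_fin ler_piMr// exprn_ge0.
have scvg : {ae mu, forall z, cvgn (s ^~ z)}.
  apply: filterS (integrable_ae measurableT IG) => z /(_ I) Gz.
  rewrite (_ : s ^~ z = series (fun i => q ^+ i * x i z)); last exact/funext.
  apply: normed_cvg.
  apply: (@series_le_cvg _ _ (fun i => q ^+ i * (1 + x i z ^+ 2))).
  - by move=> i; exact: normr_ge0.
  - by move=> i; rewrite mulr_ge0// ?exprn_ge0// addr_ge0// sqr_ge0.
  - move=> i /=; rewrite normrM ger0_norm ?exprn_ge0// ler_wpM2l ?exprn_ge0//.
    by rewrite -(real_normK (num_real (x i z))); nra.
  apply: nondecreasing_is_cvgn.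
    apply/nondecreasing_seqP => n; rewrite /series/= big_nat_recr//= lerDl.
    by rewrite mulr_ge0// ?exprn_ge0// addr_ge0// sqr_ge0.
  exists (3 / 2 + fine (G z)) => _ [n _ <-]; rewrite /series/=.
  under eq_bigr do rewrite mulrDr mulr1.
  rewrite big_split/= lerD//.
    by rewrite (le_trans (sum_geometric3_le _ _))// expr0 mulr1.
  rewrite -lee_fin fineK// -sumEFin.
  by apply: nneseries_lim_ge => i _ _; exact: term0.
(* The limit superior is measurable on the whole space and equals the limit wherever the partial
   sums converge. *)
pose y z := fine (limn_esup (fun n => (s n z)%:E)).
have my : measurable_fun setT y.
  apply: measurableT_comp => //; apply: measurable_fun_limn_esup => n.
  by apply/measurable_EFinP; have [] := Ls n.
have sy : {ae mu, forall z, s ^~ z @ \oo --> y z}.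
  apply: filterS scvg => z /cvg_ex[l sl].
  rewrite (_ : y z = l)// /y.
  have [_ ->//] := cvg_limn_einf_sup (cvgn_EFin sl).
have key n : L2 mu (fun z => y z - s n z) /\
    sqnorm mu (fun z => y z - s n z) <= (3 / 2 * q ^+ n) ^+ 2.
  apply: (@L2_ae_limit (fun m z => s (m + n)%N z - s n z)) => //.
  - by move=> m; exact: L2_sub.
  - by apply: measurable_funB => //; have [] := Ls n.
  apply: filterS sy => z syz.
  apply: cvgB; last exact: cvg_cst.
  by move: syz; rewrite -(cvg_shiftn n).
exists y; last by move=> n; have [] := key n.
have [L0 _] := key 0.
rewrite (_ : y = fun z => (y z - s 0 z) + s 0 z); last first.
  by apply/funext => z; rewrite subrK.
exact: L2_add.
Unshelve. all: by end_near. Qed.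


End completeness.

(** * Uniform boundedness on L2 *)

Section uniform_boundedness.
Context d (T : measurableType d) (R : realType).
Variable mu : {measure set T -> \bar R}.
Variable f : nat -> (T -> R) -> R.
Hypothesis fD : forall k u v, L2 mu u -> L2 mu v ->
  f k (fun x => u x + v x) = f k u + f k v.
Hypothesis fZ : forall k a u, L2 mu u -> f k (fun x => a * u x) = a * f k u.
Hypothesis fM : forall k, exists M, forall u, L2 mu u ->
  f k u ^+ 2 <= M * sqnorm mu u.
Hypothesis fB : forall u, L2 mu u -> exists B : R, forall k, `|f k u| <= B.

Let ball_image k := [set `|f k u| | u in [set u | L2 mu u /\ sqnorm mu u <= 1]].

Let sqnorm0 : sqnorm mu (fun=> 0) = 0.
Proof. by rewrite /sqnorm expr0n Rintegral_cst// mul0r. Qed.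

Let ball_image_sup k : has_sup (ball_image k).
Proof.
split.
  by exists `|f k (fun=> 0)|, (fun=> 0) => //; split; [exact: L2_0|rewrite sqnorm0].
have [M fkM] := fM k; exists (1 + `|M|) => _ [u [Lu u1] <-].
have : f k u ^+ 2 <= `|M|.
  apply: (le_trans (fkM u Lu)); apply: (le_trans (ler_norm _)).
  by rewrite normrM ler_piMr// ger0_norm// sqnorm_ge0.
rewrite -(real_normK (num_real (f k u))).
by have := normr_ge0 (f k u); have := normr_ge0 M; nra.
Qed.

(** The operator norm of [f k], finite by [fM]; the issue is its uniformity in k. *)
Let L k := sup (ball_image k).

Let L_ge0 k : 0 <= L k.
Proof.
apply: le_trans (normr_ge0 (f k (fun=> 0))) _.
apply: ub_le_sup; first by have [] := ball_image_sup k.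
by exists (fun=> 0) => //; split; [exact: L2_0|rewrite sqnorm0].
Qed.

Let f_le k u r : 0 < r -> L2 mu u -> sqnorm mu u <= r ^+ 2 -> `|f k u| <= L k * r.
Proof.
move=> r0 Lu ur; rewrite -ler_pdivrMr//.
have -> : `|f k u| / r = `|f k (fun x => r^-1 * u x)|.
  by rewrite fZ// normrM mulrC gtr0_norm// invr_gt0.
apply: ub_le_sup; first by have [] := ball_image_sup k.
exists (fun x => r^-1 * u x) => //; split; first exact: L2_scale.
by rewrite sqnormZ// exprVn ler_pdivrMl ?mulr1// exprn_gt0.
Qed.

(** The supremum need not be attained. Any fraction above 1/2 could replace 3/4: it only has to beat
    the tail of the series. *)
Let near_max k : exists x, [/\ L2 mu x, sqnorm mu x <= 1 & 3 / 4 * L k <= `|f k x|].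
Proof.
have [L0|Ln0] := eqVneq (L k) 0.
  by exists (fun=> 0); split; [exact: L2_0|rewrite sqnorm0|rewrite L0 mulr0].
have Lp : 0 < L k by rewrite lt_neqAle eq_sym Ln0 L_ge0.
have e0 : 0 < L k / 4 by rewrite divr_gt0.
have [_ [x [Lx x1] <-]] := sup_adherent e0 (ball_image_sup k).
by rewrite -/(L k) => fx; exists x; split => //; lra.
Qed.

Let q : R := 3^-1.

(* Sokal's gliding hump: each term of the geometric series is added with the
   sign that makes the corresponding functional large. *)
Lemma uniform_boundedness : exists C, forall k u, L2 mu u ->
  f k u ^+ 2 <= C * sqnorm mu u.
Proof.
have q0 n : 0 < q ^+ n by rewrite exprn_gt0// invr_gt0.
have [[C LC]|unbounded] := pselect (exists C, forall k, L k <= C).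
  have C0 : 0 <= C by exact: le_trans (LC 0).
  exists (C ^+ 2) => k u Lu.
  (* [f_le] requires a positive radius; for u of norm 0 the bound [fM] for this k alone suffices. *)
  have [u0|un0] := eqVneq (sqnorm mu u) 0.
    by have [M /(_ u Lu)] := fM k; rewrite u0 !mulr0.
  have up : 0 < sqnorm mu u by rewrite lt_neqAle eq_sym un0 sqnorm_ge0.
  have r0 : 0 < Num.sqrt (sqnorm mu u) by rewrite sqrtr_gt0.
  have := f_le k r0 Lu; rewrite (sqr_sqrtr (ltW up)) => /(_ (lexx _)) fL.
  rewrite -[sqnorm mu u in leRHS](sqr_sqrtr (ltW up)) -exprMn.
  rewrite -(real_normK (num_real (f k u))) lerXn2r ?nnegrE//.
    by rewrite mulr_ge0// ltW.
  by rewrite (le_trans fL)// ler_wpM2r// ltW.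
(* At stage j the hump is at least 3/4 q^j L and the tail at most 3/2 q^(j+1) L = 1/2 q^j L. The
   difference q^j L / 4 exceeds j exactly under this threshold. *)
have /choice[k_ Lk] : forall j : nat, exists k, 4 * j%:R / q ^+ j < L k.
  move=> j; apply: contrapT => /forallNP Lj; apply: unbounded.
  by exists (4 * j%:R / q ^+ j) => k; rewrite leNgt; exact/negP.
have /choice[x_ x_P] := fun j => near_max (k_ j).
pose sg j (Y : T -> R) : R :=
  if `|f (k_ j) (fun z => Y z - q ^+ j * x_ j z)| <=
     `|f (k_ j) (fun z => Y z + q ^+ j * x_ j z)| then 1 else -1.
pose Y := fix Y n := if n is j.+1 then
  fun z => Y j z + q ^+ j * (sg j (Y j) * x_ j z) else fun=> 0.
have Y0 : Y 0%N = fun=> 0 by [].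
have YS j : Y j.+1 = fun z => Y j z + q ^+ j * (sg j (Y j) * x_ j z) by [].
clearbody Y.
pose X j z := sg j (Y j) * x_ j z.
have YE n z : Y n z = \sum_(0 <= i < n) q ^+ i * X i z.
  elim: n => [|n IH]; first by rewrite big_geq// Y0.
  by rewrite big_nat_recr//= YS IH.
have sg2 j Z : sg j Z ^+ 2 = 1 by rewrite /sg; case: ifP => _; rewrite ?sqrrN expr1n.
have LX j : L2 mu (X j) by apply: L2_scale; have [] := x_P j.
have X1 j : sqnorm mu (X j) <= 1.
  by have [Lx x1 _] := x_P j; rewrite sqnormZ// sg2 mul1r.
have LY n : L2 mu (Y n).
  rewrite (_ : Y n = fun z => \sum_(0 <= i < n) q ^+ i * X i z); last exact/funext.
  by apply: L2_sum => i _; exact: L2_scale.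
have [y Ly yY] := L2_geometric_series LX X1.
have [B fyB] := fB Ly.
have [j Bj] : exists j : nat, B < j%:R.
  by exists (Num.bound B); rewrite archi_boundP// (le_trans _ (fyB 0%N)).
set k := k_ j.
have [Lxj xj1 xjL] := x_P j.
have Lqx a : L2 mu (fun z => a * x_ j z) by exact: L2_scale.
have hump : q ^+ j * `|f k (x_ j)| <= `|f k (Y j.+1)|.
  have -> : Y j.+1 = fun z => Y j z + (q ^+ j * sg j (Y j)) * x_ j z.
    by rewrite YS; apply/funext => z; rewrite mulrA.
  rewrite fD// fZ// /sg.
  rewrite (_ : (fun z => Y j z - q ^+ j * x_ j z) =
      fun z => Y j z + (- q ^+ j) * x_ j z); last first.
    by apply/funext => z; rewrite mulNr.
  rewrite !fD// !fZ// -/k -[in leLHS](gtr0_norm (q0 j)) -normrM.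
  move: (f k (Y j)) (q ^+ j) (f k (x_ j)) => A r B'.
  (* So the larger of the two values on the right is at least |r B'|, whatever the earlier terms
     contributed. *)
  have tri : 2 * `|r * B'| <= `|A + r * B'| + `|A - r * B'|.
    rewrite -[2]ger0_norm// -normrM (_ : 2 * _ = (A + r * B') - (A - r * B')).
      exact: ler_normB.
    by ring.
  case: ifPn; rewrite ?mulr1 ?mulrN1 !mulNr -?ltNge => h; lra.
have tail : `|f k (fun z => y z - Y j.+1 z)| <= L k * (3 / 2 * q ^+ j.+1).
  apply: f_le; first by rewrite mulr_gt0.
    exact: L2_sub.
  rewrite (_ : (fun z => _) = (fun z => y z - \sum_(0 <= i < j.+1) q ^+ i * X i z)) //.
  by apply/funext => z; rewrite YE.
have fyE : f k y = f k (Y j.+1) + f k (fun z => y z - Y j.+1 z).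
  rewrite -fD//; last exact: L2_sub.
  by congr f; apply/funext => z; rewrite addrC subrK.
have := Lk j; rewrite -/k ltr_pdivrMr// => jL.
exfalso; have := fyB k; rewrite fyE; apply/negP; rewrite -ltNge.
apply: lt_le_trans (lerB_normD _ _).
have : q ^+ j * (3 / 4 * L k) <= `|f k (Y j.+1)|.
  by apply: le_trans hump; rewrite ler_pM2l.
move: tail; rewrite exprS /q; lra.
Qed.

End uniform_boundedness.

(** * Truncated adjoints *)

Section adjoint_pairs.
Context d (T : measurableType d) (R : realType).
Variable mu : {measure set T -> \bar R}.

Lemma Rintegral_ae_eq (f g : T -> R) : measurable_fun setT f ->
  measurable_fun setT g -> {ae mu, forall x, f x = g x} ->
  \int[mu]_x f x = \int[mu]_x g x.
Proof.
move=> mf mg fg; rewrite /Rintegral; congr fine; apply: ae_eq_integral => //.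
- exact/measurable_EFinP.
- exact/measurable_EFinP.
by apply: filterS fg => x fgx _; rewrite fgx.
Qed.

(** Eventual membership of almost every point is what dominated convergence needs, and it passes to
    intersections. *)
Definition exhausts (E : nat -> set T) :=
  (forall k, measurable (E k)) /\ {ae mu, forall z, \forall k \near \oo, E k z}.

(* [A'] is the adjoint of [A] tested against functions supported in one of the
   exhausting sets [E k], with a bound that depends on [k]. *)
Definition adjoint_pair (A A' : (T -> R) -> T -> R) : Prop :=
  [/\ forall u, L2 mu u -> measurable_fun setT (A u),
      forall a u v, L2 mu u -> L2 mu v ->
        {ae mu, forall z, A (fun x => a * u x + v x) z = a * A u z + A v z} &
      exists2 E, exhausts E & forall k, exists M, forall u v, L2 mu u -> L2 mu v ->
        (forall z, ~ E k z -> v z = 0) ->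
        [/\ mu.-integrable setT (EFin \o (fun z => v z * A u z)),
            mu.-integrable setT (EFin \o (fun z => A' v z * u z)),
            \int[mu]_z (v z * A u z) = \int[mu]_z (A' v z * u z) &
            (\int[mu]_z (v z * A u z)) ^+ 2 <= M * (sqnorm mu u * sqnorm mu v)]].

Lemma exhaustsI E F : exhausts E -> exhausts F -> exhausts (fun k => E k `&` F k).
Proof.
move=> [mE aE] [mF aF]; split; first by move=> k; exact: measurableI.
by apply: filterS2 aE aF => z; exact: filterI.
Qed.

Lemma exhausts_cvg E (f : T -> R) z : (\forall k \near \oo, E k z) ->
  (fun k : nat => f z * \1_(E k) z) @ \oo --> f z.
Proof.
move=> Ez; apply: cvg_near_cst; apply: filterS Ez => k Ekz.
by rewrite indicE mem_set// mulr1.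
Qed.

Lemma Rintegral_exhausts_cvg E (f : T -> R) : exhausts E ->
  mu.-integrable setT (EFin \o f) ->
  (fun k => \int[mu]_z (f z * \1_(E k) z)) @ \oo --> \int[mu]_z f z.
Proof.
move=> [mE aE] If; have mf : measurable_fun setT f.
  exact/measurable_EFinP/(measurable_int mu).
apply: fine_cvg; rewrite fineK ?integrable_fin_num//.
have [] := @dominated_convergence _ _ _ mu setT measurableT
  (fun k z => (f z * \1_(E k) z)%:E) (EFin \o f) (abse \o (EFin \o f)) => //.
- move=> k; apply/measurable_EFinP; apply: measurable_funM => //.
- exact/measurable_EFinP.
- apply: filterS aE => z Ez _; apply: cvgn_EFin; exact: exhausts_cvg.
- exact: integrable_abse.
apply: aeW => z k _ /=; rewrite lee_fin normrM ler_piMr//.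
by rewrite indicE; case: (_ \in _); rewrite ?normr1 ?normr0.
Qed.

(** A test function supported in the intersection of the exhausting sets is admissible for both
    summands. *)
Lemma adjoint_pairD A A' B B' : adjoint_pair A A' -> adjoint_pair B B' ->
  adjoint_pair (fun u z => A u z + B u z) (fun u z => A' u z + B' u z).
Proof.
move=> [mA lA [E exE EA]] [mB lB [F exF FB]]; split.
- by move=> u Lu; apply: measurable_funD; [exact: mA|exact: mB].
- move=> a u v Lu Lv; apply: filterS2 (lA a u v Lu Lv) (lB a u v Lu Lv).
  by move=> z -> ->; ring.
exists (fun k => E k `&` F k); first exact: exhaustsI.
move=> k; have [M EM] := EA k; have [N FN] := FB k.
(* From (a + b)^2 <= 2 (a^2 + b^2). *)
exists (2 * (M + N)) => u v Lu Lv v0.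
have [|IA IA' eA bA] := EM u v Lu Lv.
  by move=> z Ez; apply: v0 => -[].
have [|IB IB' eB bB] := FN u v Lu Lv.
  by move=> z Fz; apply: v0 => -[].
have dE : (fun z => v z * (A u z + B u z)) = (fun z => v z * A u z + v z * B u z).
  by apply/funext => z; rewrite mulrDr.
have dE' : (fun z => (A' v z + B' v z) * u z) = (fun z => A' v z * u z + B' v z * u z).
  by apply/funext => z; rewrite mulrDl.
rewrite dE dE'; split.
- exact: integrable_add.
- exact: integrable_add.
- by rewrite !RintegralD// eA eB.
rewrite RintegralD//.
move: (\int[mu]_z (v z * A u z)) (\int[mu]_z (v z * B u z)) bA bB => a b.
by have := sqr_ge0 (a - b); nra.
Qed.

End adjoint_pairs.

(** * Adjoints of operators that map L2 into itself *)

Section everywhere_defined.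
Context d (T : measurableType d) (R : realType).
Variable mu : {sigma_finite_measure set T -> \bar R}.
Variables A A' : (T -> R) -> T -> R.
Hypotheses (AA' : adjoint_pair mu A A') (A'A : adjoint_pair mu A' A).
Hypothesis L2A : forall u, L2 mu u -> L2 mu (A u).

Let AD u v : L2 mu u -> L2 mu v ->
  {ae mu, forall z, A (fun x => u x + v x) z = A u z + A v z}.
Proof.
have [_ linA _] := AA' => Lu Lv; have := linA 1 u v Lu Lv.
rewrite (_ : (fun x => 1 * u x + v x) = (fun x => u x + v x)); last first.
  by apply/funext => x; rewrite mul1r.
by apply: filterS => z ->; rewrite mul1r.
Qed.

Let AZ a u : L2 mu u -> {ae mu, forall z, A (fun x => a * u x) z = a * A u z}.
Proof.
have [_ linA _] := AA' => Lu; have L0 := L2_0 mu.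
have A0 : {ae mu, forall z, A (fun=> 0) z = 0}.
  have := AD L0 L0; rewrite (_ : (fun _ => _) = (fun=> 0)); last first.
    by apply/funext => x; rewrite addr0.
  by apply: filterS => z e; apply: (addrI (A (fun=> 0) z)); rewrite -e addr0.
have := linA a u _ Lu L0.
rewrite (_ : (fun x => a * u x + 0) = (fun x => a * u x)); last first.
  by apply/funext => x; rewrite addr0.
by apply: filterS2 A0 => z -> ->; rewrite addr0.
Qed.

Let pairing_bounded v : L2 mu v ->
  exists2 C : R, 0 <= C & forall u, L2 mu u ->
    (\int[mu]_z (v z * A u z)) ^+ 2 <= C * sqnorm mu u.
Proof.
have [mA _ [E exE EM]] := AA' => Lv; have [mE aE] := exE.
pose w k z := v z * \1_(E k) z.
have Lw k : L2 mu (w k) by exact: L2_indic.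
have Iw k u : L2 mu u -> mu.-integrable setT (EFin \o (fun z => w k z * A u z)).
  by move=> Lu; apply: L2_mul => //; exact: L2A.
pose f k u := \int[mu]_z (w k z * A u z).
have [C fC] : exists C, forall k u, L2 mu u -> f k u ^+ 2 <= C * sqnorm mu u.
  apply: uniform_boundedness.
  - move=> k u u' Lu Lu'; rewrite /f -RintegralD; [|by []|exact: Iw|exact: Iw].
    have [mw _] := Lw k.
    apply: Rintegral_ae_eq.
    + by apply: measurable_funM => //; apply: mA; exact: L2_add.
    + by apply: measurable_funD; apply: measurable_funM => //; exact: mA.
    + by apply: filterS (AD Lu Lu') => z ->; rewrite mulrDr.
  - move=> k a u Lu; rewrite /f -RintegralZl; [|by []|exact: Iw].
    have [mw _] := Lw k.
    apply: Rintegral_ae_eq.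
    + by apply: measurable_funM => //; apply: mA; exact: L2_scale.
    + by do 2 apply: measurable_funM => //; exact: mA.
    + by apply: filterS (AZ a Lu) => z ->; rewrite mulrCA.
  - move=> k; have [M MP] := EM k; exists (M * sqnorm mu (w k)) => u Lu.
    have [|_ _ _] := MP u (w k) Lu (Lw k).
      by move=> z Ekz; rewrite /w indicE memNset// mulr0.
    by rewrite [sqnorm mu u * _]mulrC mulrA.
  (* Pointwise boundedness comes from [L2A]: v and A u are both in L2, so |v A u| is integrable, and
     it dominates every truncation. *)
  - move=> u Lu; exists (\int[mu]_z `|v z * A u z|) => k.
    have IvA : mu.-integrable setT (EFin \o (fun z => v z * A u z)).
      by apply: L2_mul => //; exact: L2A.
    apply: le_trans (le_normr_Rintegral _ (Iw k u Lu)) _ => //.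
    apply: le_Rintegral => //.
    + exact: (integrable_norm (Iw k u Lu)).
    + exact: (integrable_norm IvA).
    + move=> z _; rewrite /w -mulrA [_ * A u z]mulrC mulrA [leLHS]normrM ler_piMr//.
      by rewrite indicE; case: (_ \in _); rewrite ?normr1 ?normr0.
exists `|C| => // u Lu.
apply: (@le_trans _ _ (C * sqnorm mu u)); last first.
  by rewrite ler_wpM2r ?sqnorm_ge0// ler_norm.
have fu : f ^~ u @ \oo --> \int[mu]_z (v z * A u z).
  rewrite (_ : f ^~ u = fun k => \int[mu]_z (v z * A u z * \1_(E k) z)).
    by apply: Rintegral_exhausts_cvg => //; apply: L2_mul => //; exact: L2A.
  by apply/funext => k; apply: eq_Rintegral => z _; rewrite /w mulrAC.
apply: (cvgr_to_le (cvgM fu fu)); apply: nearW => k /=.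
by rewrite -expr2; exact: fC.
Qed.

Lemma L2_adjoint v : L2 mu v -> L2 mu (A' v).
Proof.
have [mA' _ [F exF FM]] := A'A => Lv; have [C C0 AC] := pairing_bounded Lv.
have mA'v := mA' v Lv.
have /sigma_finiteP[S [ST ndS Sfin]] := sigma_finiteT mu.
(* A' v is so far only measurable. Cutting it to [S k], of finite measure, and to [B k], where it is
   bounded, makes it square integrable; cutting it to [F k] makes it an admissible test function. *)
pose B (k : nat) := [set z | `|A' v z| <= k%:R].
have mB k : measurable (B k).
  have mn : measurable_fun setT (fun z => `|A' v z|) by exact: measurableT_comp.
  have := mn measurableT _ (measurable_itv `]-oo, k%:R]).
  rewrite setTI (_ : _ @^-1` _ = B k)//.
have exG : exhausts mu (fun k => F k `&` (S k `&` B k)).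
  apply: exhaustsI => //; split.
    by move=> k; apply: measurableI => //; have [] := Sfin k.
  apply: aeW => z; have : [set: T] z by [].
  rewrite ST => -[n _ Snz]; near=> k; split.
    by move: Snz; apply/subsetPset/ndS; near: k; exact: nbhs_infty_ge.
  by rewrite /B/=; near: k; exact: nbhs_infty_ger.
have [mG aG] := exG.
pose w k z := A' v z * \1_(F k `&` (S k `&` B k)) z.
have mw k : measurable_fun setT (w k).
  by apply: measurable_funM => //; exact: measurable_indic.
have Lw k : L2 mu (w k).
  split=> //.
  apply: (@integrable_le _ _ _ _ _ (fun z => k%:R ^+ 2 * \1_(S k) z)).
  - exact: measurable_funX.
  - move=> z; rewrite normrX /w !indicE !in_setI normrM.
    case: (boolP (z \in F k)); rewrite ?andbF ?normr0 ?mulr0 ?expr0n ?mulr_ge0//= => _.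
    case: (z \in S k); rewrite ?normr0 ?mulr0 ?expr0n//=.
    case: (boolP (z \in B k)); rewrite ?normr0 ?mulr0 ?expr0n ?mulr1 ?sqr_ge0//=.
    by rewrite inE normr1 mulr1 => zB; rewrite lerXn2r// nnegrE.
  - apply: integrable_scale; have [mS Slt] := Sfin k.
    apply/integrableP; split; first by apply/measurable_EFinP; exact: measurable_indic.
    rewrite (eq_integral (fun z => (\1_(S k) z)%:E)); last first.
      by move=> z _; rewrite gee0_abs// lee_fin.
    by rewrite integral_indic// setIT.
have w1 k : sqnorm mu (w k) <= C.
  have [M FMk] := FM k; have [|_ _ e _] := FMk v (w k) Lv (Lw k).
    by move=> z Fkz; rewrite /w indicE memNset ?mulr0// => -[].
  (* Writing w for [w k]: |w|^2 = <A' v, w> = <v, A w>, whose square is at most C |w|^2. Dividing by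
     |w|^2 leaves a bound independent of k. *)
  have eq1 : sqnorm mu (w k) = \int[mu]_z (v z * A (w k) z).
    rewrite (_ : (fun z => _) = (fun z => A (w k) z * v z)); last first.
      by apply/funext => z; rewrite mulrC.
    rewrite -e; apply: eq_Rintegral => z _; rewrite /w.
    by rewrite expr2 indicE; case: (_ \in _); rewrite ?mulr1 ?mulr0 ?mul0r.
  have := AC (w k) (Lw k); rewrite -eq1.
  have := sqnorm_ge0 mu (w k); rewrite le_eqVlt => /predU1P[<-//|w0].
  by rewrite expr2 ler_pM2r.
have [] // := L2_ae_limit Lw w1 mA'v.
apply: filterS aG => z; exact: exhausts_cvg.
Unshelve. all: by end_near. Qed.

Lemma adjoint_identity u v : L2 mu u -> L2 mu v ->
  \int[mu]_z (v z * A u z) = \int[mu]_z (A' v z * u z).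
Proof.
have [mA _ _] := AA'; have [mA' _ [F exF FM]] := A'A => Lu Lv.
have [C C0 AC] := pairing_bounded Lv; have [mF aF] := exF.
have LA'v := L2_adjoint Lv; have IA'v := L2_mul LA'v Lu.
pose w k z := u z * \1_(F k) z.
have Lw k : L2 mu (w k) by exact: L2_indic.
(* The difference is <v, A (u - w k)>, which [pairing_bounded] controls. Since [w k] and u - [w k]
   have disjoint supports, |u - w k|^2 = |u|^2 - |w k|^2, and this tends to 0. *)
have err k : (\int[mu]_z (v z * A u z) -
    \int[mu]_z (A' v z * u z * \1_(F k) z)) ^+ 2 <=
    C * (sqnorm mu u - \int[mu]_z (u z ^+ 2 * \1_(F k) z)).
  have [M FMk] := FM k; have [|_ _ e _] := FMk v (w k) Lv (Lw k).
    by move=> z Fkz; rewrite /w indicE memNset ?mulr0.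
  have Ld : L2 mu (fun z => u z - w k z) by exact: L2_sub.
  have := AC _ Ld; congr (_ ^+ 2 <= _ * _).
    transitivity (\int[mu]_z (v z * A u z - v z * A (w k) z)).
      apply: Rintegral_ae_eq.
      - by have [mv _] := Lv; apply: measurable_funM => //; exact: mA.
      - have [mv _] := Lv.
        by apply: measurable_funB; apply: measurable_funM => //; exact: mA.
      have := AD Ld (Lw k); rewrite (_ : (fun _ => _) = u); last first.
        by apply/funext => z; rewrite subrK.
      by apply: filterS => z ->; rewrite mulrDr addrK.
    rewrite RintegralB//; last 2 first.
    - by apply: L2_mul => //; exact: L2A.
    - by apply: L2_mul => //; exact: L2A.
    congr (_ - _).
    rewrite (_ : (fun z => v z * A (w k) z) = (fun z => A (w k) z * v z)); last first.
      by apply/funext => z; rewrite mulrC.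
    by rewrite -e; apply: eq_Rintegral => z _; rewrite /w mulrAC [u z * _]mulrC.
  have [_ Iu] := Lu; have [_ Iwk] := Lw k.
  have -> : \int[mu]_z (u z ^+ 2 * \1_(F k) z) = sqnorm mu (w k).
    apply: eq_Rintegral => z _; rewrite /w exprMn indicE.
    by case: (_ \in _); rewrite ?expr1n ?expr0n.
  rewrite /sqnorm -RintegralB//; apply: eq_Rintegral => z _; rewrite /w indicE.
  by case: (_ \in _); rewrite ?mulr1 ?mulr0 ?subrr ?expr0n ?subr0.
pose l k := \int[mu]_z (v z * A u z) - \int[mu]_z (A' v z * u z * \1_(F k) z).
have cvgl : l @ \oo --> \int[mu]_z (v z * A u z) - \int[mu]_z (A' v z * u z).
  by apply: cvgB; [exact: cvg_cst|exact: Rintegral_exhausts_cvg].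
pose r k := C * (sqnorm mu u - \int[mu]_z (u z ^+ 2 * \1_(F k) z)).
have cvgr : r @ \oo --> C * (sqnorm mu u - sqnorm mu u).
  apply: cvgM; first exact: cvg_cst.
  apply: cvgB; first exact: cvg_cst.
  by apply: Rintegral_exhausts_cvg => //; have [] := Lu.
have := ler_cvg_to (cvgM cvgl cvgl) cvgr.
rewrite subrr mulr0 => le0.
apply/eqP; rewrite -subr_eq0 -sqrf_eq0 eq_le sqr_ge0 andbT expr2; apply: le0.
by apply: nearW => k /=; rewrite -expr2; exact: err.
Qed.

End everywhere_defined.

(** * Partial integral operators *)

Section parametric_integral.
Context d d' (Z : measurableType d) (S : measurableType d') (R : realType).
Variables (mu : {sigma_finite_measure set Z -> \bar R}).
Variables (lam : {sigma_finite_measure set S -> \bar R}).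
Local Notation mulam := (mu \x lam)%E.

(** Measurability alone suffices: the positive and negative parts have measurable partial integrals
    by Tonelli, and [fine] absorbs infinite values. *)
Lemma measurable_Rintegral (f : Z * S -> R) : measurable_fun setT f ->
  measurable_fun setT (fun z => \int[lam]_s f (z, s)).
Proof.
move=> mf; have mF : measurable_fun setT (EFin \o f) by exact/measurable_EFinP.
rewrite /Rintegral; apply: measurableT_comp => //.
rewrite (_ : (fun z => _) = (fun z =>
    (\int[lam]_s ((EFin \o f)^\+ (z, s)) - \int[lam]_s ((EFin \o f)^\- (z, s)))%E)).
  apply: emeasurable_funB.
    apply: (@measurable_fun_fubini_tonelli_F _ _ _ _ _ lam) => //.
    exact: measurable_funepos.
  apply: (@measurable_fun_fubini_tonelli_F _ _ _ _ _ lam) => //.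
  exact: measurable_funeneg.
apply/funext => z; rewrite [LHS]integralE; congr (_ - _)%E;
  by apply: eq_integral => s _; rewrite ?funeposE ?funenegE.
Qed.

(** The weight stands outside the inner integral, as in v times an operator value. It moves inside
    wherever f(z, .) is integrable, that is, for almost every z. *)
Lemma Rintegral_fubini (w : Z -> R) (f : Z * S -> R) : measurable_fun setT w ->
  measurable_fun setT f ->
  {ae mu, forall z, lam.-integrable setT (fun s => (f (z, s))%:E)} ->
  mulam.-integrable setT (EFin \o (fun p => w p.1 * f p)) ->
  mu.-integrable setT (EFin \o (fun z => w z * \int[lam]_s f (z, s))) /\
  \int[mu]_z (w z * \int[lam]_s f (z, s)) = \int[mulam]_p (w p.1 * f p).
Proof.
move=> mw mf aef Iwf.
pose F := fubini_F lam (EFin \o (fun p => w p.1 * f p)).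
have IF : mu.-integrable setT F by exact: integrable_fubini_F.
have mg : measurable_fun setT (fun z => w z * \int[lam]_s f (z, s)).
  by apply: measurable_funM => //; exact: measurable_Rintegral.
have eqF : ae_eq mu setT F (EFin \o (fun z => w z * \int[lam]_s f (z, s))).
  apply: filterS aef => z Iz _; rewrite /F /fubini_F/=.
  rewrite -RintegralZl// /Rintegral fineK//.
  apply: integrable_fin_num => //.
  exact: (integrable_scale (w z) (f := fun s => f (z, s))).
have mgE : measurable_fun setT (EFin \o (fun z => w z * \int[lam]_s f (z, s))).
  exact/measurable_EFinP.
have mF := measurable_int mu IF.
split.
  move/integrableP: IF => [_ IF]; apply/integrableP; split => //.
  apply: le_lt_trans IF; rewrite le_eqVlt; apply/orP; left; apply/eqP.
  apply: ae_eq_integral => //; [exact: measurableT_comp|exact: measurableT_comp|].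
  exact/ae_eq_abse/ae_eq_sym.
rewrite /Rintegral -(integral12_prod_meas1 Iwf) -/F.
by congr fine; apply: ae_eq_integral => //; exact: ae_eq_sym.
Qed.

End parametric_integral.

Section kernel_operator.
Context d d' (Z : measurableType d) (S : measurableType d') (R : realType).
Variables (mu : {sigma_finite_measure set Z -> \bar R}).
Variables (lam : {sigma_finite_measure set S -> \bar R}).
Local Notation mulam := (mu \x lam)%E.

(** Invariance is expressed by integrals of nonnegative functions, the form in which Tonelli's
    theorem yields it. *)
Definition measure_preserving_involution (tau : Z * S -> Z * S) :=
  [/\ measurable_fun setT tau, involutive tau &
      forall F : Z * S -> \bar R, measurable_fun setT F ->
        (forall p, 0 <= F p)%E ->
        (\int[mulam]_p F (tau p) = \int[mulam]_p F p)%E].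

Variable tau : Z * S -> Z * S.
Hypothesis tauP : measure_preserving_involution tau.

(* Taking for [tau] the exchange of x and theta, of y and nu, or of (x, y) and
   (theta, nu) gives the three kinds of partial integrals of P[N]; the adjoint
   kernel is then [K \o tau]. *)
Definition kernel_operator (K : Z * S -> R) (u : Z -> R) (z : Z) : R :=
  \int[lam]_s (K (z, s) * u (tau (z, s)).1).

Lemma L2_involution (F : Z * S -> R) : L2 mulam F -> L2 mulam (F \o tau).
Proof.
have [mtau _ tauI] := tauP => -[mF /integrableP[mF2 IF]].
apply: L2P; first exact: measurableT_comp.
rewrite (tauI (fun p => (F p ^+ 2)%:E))//.
  move: IF; under eq_integral do rewrite /= ger0_norm ?sqr_ge0//.
  by [].
by move=> p; rewrite lee_fin sqr_ge0.
Qed.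

Lemma integral_involution (F : Z * S -> \bar R) : measurable_fun setT F ->
  (\int[mulam]_p F (tau p) = \int[mulam]_p F p)%E.
Proof.
have [mtau _ tauI] := tauP => mF; rewrite integralE [RHS]integralE; congr (_ - _)%E.
  rewrite -[fun p => F (tau p)]/(F \o tau) funepos_comp.
  by apply: tauI => //; exact: measurable_funepos.
rewrite -[fun p => F (tau p)]/(F \o tau) funeneg_comp.
by apply: tauI => //; exact: measurable_funeneg.
Qed.

Variables (B : set (Z * S)) (beta : R).
Hypothesis beta0 : 0 <= beta.
Hypothesis mB : measurable B.
Hypothesis tauB : forall p, B p -> B (tau p).
Hypothesis lamB : forall z, (lam (xsection B z) <= beta%:E)%E.

(** Seen as a function on the product, u is constant in one variable and has no reason to be square
    integrable; the cut to [B], whose sections have bounded measure, makes it so. *)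
Let lift (u : Z -> R) p := \1_B p * u (tau p).1.

Let indicB p : \1_B (tau p) = \1_B p :> R.
Proof.
have [_ tauK _] := tauP; rewrite !indicE; congr (_%:R : R); congr nat_of_bool.
apply/idP/idP; rewrite !inE; last exact: tauB.
by move=> /tauB; rewrite tauK.
Qed.

Let mtau1 : measurable_fun setT (fun p => (tau p).1).
Proof. by have [mtau _ _] := tauP; exact: measurableT_comp. Qed.

(** Applying [tau] turns the squared norm into the integral of 1_B(z, s) u(z)^2, and integrating in
    s first gives at most beta u(z)^2. *)
Let L2_lift u : L2 mu u ->
  L2 mulam (lift u) /\ sqnorm mulam (lift u) <= beta * sqnorm mu u.
Proof.
have [mtau tauK tauI] := tauP => Lu; have [mu' Iu] := Lu.
have mu1 : measurable_fun setT (fun p : Z * S => u p.1) by exact: measurableT_comp.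
have ml : measurable_fun setT (lift u).
  apply: measurable_funM; first exact: measurable_indic.
  exact: (measurableT_comp mu' mtau1).
have le : (\int[mulam]_p ((lift u p ^+ 2)%:E) <= (beta * sqnorm mu u)%:E)%E.
  pose F (p : Z * S) : \bar R := (\1_B p * u p.1 ^+ 2)%:E.
  have mF : measurable_fun setT F.
    by apply/measurable_EFinP; apply: measurable_funM => //; exact: measurable_funX.
  have F0 p : (0 <= F p)%E by rewrite lee_fin mulr_ge0 ?sqr_ge0.
  rewrite (eq_integral (F \o tau)); last first.
    move=> p _; rewrite /F /lift /= indicB exprMn indicE.
    by case: (_ \in _); rewrite ?expr1n ?expr0n.
  rewrite tauI// fubini_tonelli1//.
  apply: (@le_trans _ _ (\int[mu]_z (beta%:E * (u z ^+ 2)%:E))%E).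
    apply: ge0_le_integral => //.
    - by move=> z _; apply: integral_ge0 => s _; exact: F0.
    - exact: measurable_fun_fubini_tonelli_F.
    - apply/measurable_EFinP; apply: measurable_funM => //; exact: measurable_funX.
    - move=> z _; rewrite /fubini_F /F/=.
      under eq_integral do rewrite EFinM muleC.
      rewrite ge0_integralZl_EFin ?sqr_ge0//; last first.
        by apply/measurable_EFinP; exact: (measurableT_comp (measurable_indic _)).
      rewrite muleC; apply: lee_wpmul2r; first by rewrite lee_fin sqr_ge0.
      apply: le_trans (lamB z).
      rewrite (eq_integral (fun s => (\1_(xsection B z) s)%:E)); last first.
        by move=> s _; rewrite !indicE mem_xsection.
      by rewrite integral_indic ?setIT//; exact: measurable_xsection.
  rewrite ge0_integralZl_EFin//; last 2 first.
  - by move=> z _; rewrite lee_fin sqr_ge0.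
  - by apply/measurable_EFinP; exact: measurable_funX.
  by rewrite EFinM sqnormE.
have Ll : L2 mulam (lift u) by apply: L2P => //; exact: le_lt_trans le (ltry _).
by split => //; rewrite -lee_fin sqnormE.
Qed.

Let kernel_integrand K u : (forall p, ~ B p -> K p = 0) ->
  (fun p => K p * u (tau p).1) = (fun p => K p * lift u p).
Proof.
move=> K0; apply/funext => p; rewrite /lift indicE.
by case: (boolP (p \in B)) => [|/negP pB]; rewrite ?mul1r// K0 ?mul0r// => /mem_set.
Qed.

Lemma kernel_integrable K u : L2 mulam K -> (forall p, ~ B p -> K p = 0) ->
  L2 mu u -> mulam.-integrable setT (EFin \o (fun p => K p * u (tau p).1)).
Proof.
move=> LK K0 Lu; rewrite kernel_integrand//.
by apply: L2_mul => //; have [] := L2_lift Lu.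
Qed.

(** The source of all almost everywhere statements on operators: at the exceptional z the integral
    of a sum need not be the sum of the integrals. *)
Lemma kernel_ae_integrable K u : L2 mulam K -> (forall p, ~ B p -> K p = 0) ->
  L2 mu u -> {ae mu, forall z,
    lam.-integrable setT (fun s => (K (z, s) * u (tau (z, s)).1)%:E)}.
Proof. by move=> LK K0 Lu; have := ae_integrable1 (kernel_integrable LK K0 Lu). Qed.

(** Both pairings are double integrals of one function [H], the second after the substitution [tau].
    Truncating v is what makes [H] integrable. *)
Lemma kernel_adjoint_pair K : L2 mulam K -> (forall p, ~ B p -> K p = 0) ->
  adjoint_pair mu (kernel_operator K) (kernel_operator (K \o tau)).
Proof.
have [mtau tauK tauI] := tauP => LK K0.
have LK' := L2_involution LK.
have K0' p : ~ B p -> (K \o tau) p = 0.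
  by move=> pB; apply: K0; apply: contra_not pB => /tauB; rewrite tauK.
have [mK IK] := LK; have [mK' IK'] := LK'.
split.
- move=> u [mu' _]; apply: (measurable_Rintegral lam (f := fun p => K p * u (tau p).1)).
  by apply: measurable_funM => //; exact: measurableT_comp.
- move=> a u v Lu Lv.
  apply: filterS2 (kernel_ae_integrable LK K0 Lu) (kernel_ae_integrable LK K0 Lv).
  move=> z Iu Iv; rewrite /kernel_operator -RintegralZl// -RintegralD//; last first.
    exact: (integrable_scale a (f := fun s => K (z, s) * u (tau (z, s)).1)).
  by apply: eq_Rintegral => s _; ring.
(* The squared partial norm of the kernel; it is integrable because K is in L2, hence finite almost
   everywhere, and its sublevel sets exhaust the space. *)
pose h z := (\int[lam]_s ((K (z, s) ^+ 2)%:E))%E.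
have mK2 : measurable_fun setT (fun p => (K p ^+ 2)%:E).
  by apply/measurable_EFinP; exact: measurable_funX.
have K20 p : (0 <= (K p ^+ 2)%:E)%E by rewrite lee_fin sqr_ge0.
have Ih : mu.-integrable setT h by exact: (integrable_fubini_F IK).
have mh := measurable_int mu Ih.
have h0 z : (0 <= h z)%E by exact: integral_ge0.
exists (fun k => [set z | (h z <= k%:R%:E)%E]).
  split.
    move=> k; have := mh measurableT _ (emeasurable_itv `]-oo, k%:R%:E]).
    by rewrite setTI.
  apply: filterS (integrable_ae measurableT Ih) => z /(_ I) hz.
  near=> k; rewrite /= -(fineK hz) lee_fin; near: k; exact: nbhs_infty_ger.
move=> k; exists (k%:R * beta) => u v Lu Lv v0.
have [mv Iv] := Lv; have [mu' Iu] := Lu.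
have [Ll lle] := L2_lift Lu.
(* v is grouped with K, not with u: on the support of v the partial norm is at most k, so |G|^2 <= k
   |v|^2. With |lift u|^2 <= beta |u|^2, Cauchy-Schwarz gives the constant k beta. *)
pose G (p : Z * S) := v p.1 * K p.
have mG : measurable_fun setT G.
  by apply: measurable_funM => //; exact: measurableT_comp.
have leG : (\int[mulam]_p ((G p ^+ 2)%:E) <= (k%:R * sqnorm mu v)%:E)%E.
  rewrite fubini_tonelli1//; last first.
  - by move=> p; rewrite lee_fin sqr_ge0.
  - by apply/measurable_EFinP; exact: measurable_funX.
  apply: (@le_trans _ _ (\int[mu]_z (k%:R%:E * (v z ^+ 2)%:E))%E).
    apply: ge0_le_integral => //.
    - by move=> z _; apply: integral_ge0 => s _; rewrite lee_fin sqr_ge0.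
    - apply: measurable_fun_fubini_tonelli_F => [|p]; last by rewrite lee_fin sqr_ge0.
      by apply/measurable_EFinP; exact: measurable_funX.
    - by apply/measurable_EFinP; apply: measurable_funM => //; exact: measurable_funX.
    - move=> z _; rewrite /fubini_F /G/=.
      under eq_integral do rewrite exprMn EFinM.
      rewrite ge0_integralZl_EFin ?sqr_ge0//; last first.
        exact: (measurableT_comp mK2 (measurable_pair1 z)).
      rewrite muleC -/(h z).
      have [hk|/v0->] := pselect (h z <= k%:R%:E)%E; last by rewrite expr0n/= !mule0.
      by apply: lee_wpmul2r; rewrite ?lee_fin ?sqr_ge0.
  rewrite ge0_integralZl_EFin//; last 2 first.
  - by move=> z _; rewrite lee_fin sqr_ge0.
  - by apply/measurable_EFinP; exact: measurable_funX.
  by rewrite EFinM sqnormE.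
have LG : L2 mulam G by apply: L2P => //; exact: le_lt_trans leG (ltry _).
have Gk : sqnorm mulam G <= k%:R * sqnorm mu v by rewrite -lee_fin sqnormE.
pose H p := v p.1 * (K p * u (tau p).1).
have HE : H = fun p => G p * lift u p.
  have := kernel_integrand u K0 => /funeqP e; apply/funext => p.
  by rewrite /H e mulrA.
have IH : mulam.-integrable setT (EFin \o H) by rewrite HE; exact: L2_mul.
have mH : measurable_fun setT H.
  by apply/measurable_EFinP; have /integrableP[] := IH.
have H'E : H \o tau = fun p => u p.1 * ((K \o tau) p * v (tau p).1).
  by apply/funext => p; rewrite /H /= tauK; ring.
have IH' : mulam.-integrable setT (EFin \o (H \o tau)).
  move/integrableP: IH => [mHE IH]; apply/integrableP; split.
    by apply/measurable_EFinP; exact: measurableT_comp.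
  rewrite (tauI (fun p => `|(H p)%:E|)%E)//.
  exact: measurableT_comp.
have [I1 e1] := Rintegral_fubini mv
  (measurable_funM mK (measurableT_comp mu' mtau1))
  (kernel_ae_integrable LK K0 Lu) IH.
rewrite H'E in IH'.
have [I2 e2] := Rintegral_fubini mu'
  (measurable_funM mK' (measurableT_comp mv mtau1))
  (kernel_ae_integrable LK' K0' Lv) IH'.
have comm : (fun z => kernel_operator (K \o tau) v z * u z) =
    (fun z => u z * kernel_operator (K \o tau) v z).
  by apply/funext => z; rewrite mulrC.
rewrite comm; split => //.
  rewrite e1 e2 -/H; transitivity (\int[mulam]_p (H \o tau) p); last by rewrite H'E.
  by congr fine; apply/esym/(@integral_involution (EFin \o H)); exact/measurable_EFinP.
rewrite e1 -/H HE; apply: (le_trans (cauchy_schwarz LG Ll)).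
have b0 : 0 <= sqnorm mulam (lift u) by exact: sqnorm_ge0.
have v0' : 0 <= k%:R * sqnorm mu v by rewrite mulr_ge0 ?sqnorm_ge0.
apply: (@le_trans _ _ ((k%:R * sqnorm mu v) * (beta * sqnorm mu u))).
  by apply: ler_pM => //; exact: sqnorm_ge0.
by rewrite mulrACA [sqnorm mu v * _]mulrC.
Unshelve. all: by end_near. Qed.

End kernel_operator.

Section multiplication_operator.
Context d (T : measurableType d) (R : realType).
Variable mu : {measure set T -> \bar R}.

(** There is no integrated variable here, so the truncation bounds |K| itself: v K is dominated by k
    v on the support of v. *)
Lemma multiplication_adjoint_pair (K : T -> R) : L2 mu K ->
  adjoint_pair mu (fun u z => K z * u z) (fun u z => K z * u z).
Proof.
move=> [mK IK]; split.
- by move=> u [mu' _]; exact: measurable_funM.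
- by move=> a u v _ _; apply: aeW => z; ring.
exists (fun k => [set z | `|K z| <= k%:R]).
  split=> [k|].
    have mn : measurable_fun setT (fun z => `|K z|) by exact: measurableT_comp.
    by have := mn measurableT _ (measurable_itv `]-oo, k%:R]); rewrite setTI.
  by apply: aeW => z; near=> k; rewrite /=; near: k; exact: nbhs_infty_ger.
move=> k; exists (k%:R ^+ 2) => u v Lu Lv v0.
have [mv Iv] := Lv.
have LvK : L2 mu (fun z => v z * K z).
  apply: (L2_le _ _ (L2_scale k%:R Lv)); first exact: measurable_funM.
  move=> z; rewrite mulrC !normrM (ger0_norm (ler0n R k)).
  have [hk|/v0->] := pselect (`|K z| <= k%:R); last by rewrite normr0 !mulr0.
  by rewrite ler_wpM2r.
have -> : (fun z => v z * (K z * u z)) = (fun z => v z * K z * u z).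
  by apply/funext => z; rewrite mulrA.
have -> : (fun z => K z * v z * u z) = (fun z => v z * K z * u z).
  by apply/funext => z; rewrite [K z * _]mulrC.
split => //; [exact: L2_mul|exact: L2_mul|].
apply: (le_trans (cauchy_schwarz LvK Lu)).
rewrite [leLHS]mulrC mulrCA ler_wpM2l ?sqnorm_ge0// -sqnormZ//.
have [_ IvK] := LvK; have [_ Ikv] := L2_scale k%:R Lv.
apply: le_Rintegral => // z _; rewrite !exprMn mulrC.
have [hk|/v0->] := pselect (`|K z| <= k%:R); last by rewrite expr0n/= !mulr0.
rewrite ler_wpM2r ?sqr_ge0// -(real_normK (num_real (K z))).
by rewrite lerXn2r// nnegrE.
Unshelve. all: by end_near. Qed.

End multiplication_operator.

(* The library's sigma-finite instance on [m1 \x m2] is shadowed by the one for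
   subprobabilities; this copy carries it. *)
Section product_sigma_finite.
Context d1 d2 (T1 : measurableType d1) (T2 : measurableType d2) (R : realType).
Variables (m1 : {sigma_finite_measure set T1 -> \bar R}).
Variables (m2 : {sigma_finite_measure set T2 -> \bar R}).

Definition prod_measure := (m1 \x m2)%E.

HB.instance Definition _ := Measure.on prod_measure.

Let prod_measure_sigma_finite : sigma_finite setT prod_measure.
Proof.
have /sigma_finiteP[F [TF ndF Foo]] := sigma_finiteT m1.
have /sigma_finiteP[G [TG ndG Goo]] := sigma_finiteT m2.
exists (fun n => F n `*` G n).
  rewrite -setXTT TF TG; apply/seteqP; split=> -[x y] /=; last first.
    by move=> [n _ [Fx Gy]]; split; exists n.
  move=> [[n _ Fx] [k _ Gy]]; exists (maxn n k) => //; split => /=.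
    by move: Fx; apply/subsetPset/ndF/leq_maxl.
  by move: Gy; apply/subsetPset/ndG/leq_maxr.
move=> k; have [mF Flt] := Foo k; have [mG Glt] := Goo k.
split; first exact: measurableX.
by rewrite /prod_measure product_measure1E// lte_mul_pinfty// ge0_fin_numE.
Qed.

HB.instance Definition _ := Measure_isSigmaFinite.Build _ _ _ prod_measure
  prod_measure_sigma_finite.

End product_sigma_finite.

(** * Coordinate exchanges preserve product measures *)

Section coordinate_exchanges.
Context d1 d2 (T1 : measurableType d1) (T2 : measurableType d2) (R : realType).
Variables (m1 : {sigma_finite_measure set T1 -> \bar R}).
Variables (m2 : {sigma_finite_measure set T2 -> \bar R}).

Local Notation m12 := (prod_measure m1 m2).

Definition exchange_x (p : T1 * T2 * T1) : T1 * T2 * T1 := (p.2, p.1.2, p.1.1).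
Definition exchange_y (p : T1 * T2 * T2) : T1 * T2 * T2 := (p.1.1, p.2, p.1.2).
Definition exchange_xy (p : (T1 * T2) * (T1 * T2)) : (T1 * T2) * (T1 * T2) :=
  (p.2, p.1).

Lemma tonelli3 d3 (T3 : measurableType d3)
    (m3 : {sigma_finite_measure set T3 -> \bar R}) (F : T1 * T2 * T3 -> \bar R) :
  measurable_fun setT F -> (forall p, 0 <= F p)%E ->
  (\int[m12 \x m3]_p F p = \int[m1]_x \int[m2]_y \int[m3]_s F (x, y, s))%E.
Proof.
move=> mF F0; rewrite (@fubini_tonelli1 _ _ _ _ _ m12 m3)//.
apply: (@fubini_tonelli1 _ _ _ _ _ m1 m2).
- exact: measurable_fun_fubini_tonelli_F.
- by move=> z; exact: integral_ge0.
Qed.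

Lemma exchange_xP : measure_preserving_involution m12 m1 exchange_x.
Proof.
have mx : measurable_fun setT exchange_x.
  apply: measurable_fun_pair; last exact: measurableT_comp.
  by apply: measurable_fun_pair => //; exact: measurableT_comp.
split=> //; first by case=> [[]].
move=> F mF F0.
have mFx : measurable_fun setT (fun p => F (exchange_x p)) by exact: measurableT_comp.
transitivity (\int[m1]_x \int[m2]_y \int[m1]_t F (t, y, x))%E.
  exact: (@tonelli3 _ _ m1 (fun p => F (exchange_x p))).
(* For fixed x, the two inner integrals merge into one over the point (t, y). *)
transitivity (\int[m1]_x \int[m12]_z F (z, x))%E; last first.
  exact/esym/(@fubini_tonelli2 _ _ _ _ _ m12 m1 F).
apply: eq_integral => x _.
apply/esym/(@fubini_tonelli2 _ _ _ _ _ m1 m2 (fun z => F (z, x))) => [|//].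
exact: (measurableT_comp mF (measurable_pair2 x)).
Qed.

Lemma exchange_yP : measure_preserving_involution m12 m2 exchange_y.
Proof.
have mx : measurable_fun setT exchange_y.
  apply: measurable_fun_pair; last exact: measurableT_comp.
  by apply: measurable_fun_pair => //; exact: measurableT_comp.
split=> //; first by case=> [[]].
move=> F mF F0.
have mFx : measurable_fun setT (fun p => F (exchange_y p)) by exact: measurableT_comp.
transitivity (\int[m1]_x \int[m2]_y \int[m2]_s F (x, s, y))%E.
  exact: (@tonelli3 _ _ m2 (fun p => F (exchange_y p))).
transitivity (\int[m1]_x \int[m2]_s \int[m2]_y F (x, s, y))%E; last first.
  exact/esym/(@tonelli3 _ _ m2 F).
apply: eq_integral => x _.
apply: (@fubini_tonelli _ _ _ _ _ m2 m2 (fun q => F ((x, q.2), q.1))) => //.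
apply: (measurableT_comp mF); apply: measurable_fun_pair => //.
by apply: measurable_fun_pair.
Qed.

Lemma exchange_xyP : measure_preserving_involution m12 m12 exchange_xy.
Proof.
have mx : measurable_fun setT exchange_xy by exact: measurable_fun_pair.
split=> //; first by case.
move=> F mF F0.
have mFx : measurable_fun setT (fun p => F (exchange_xy p)) by exact: measurableT_comp.
by rewrite (@fubini_tonelli1 _ _ _ _ _ m12 m12)//
  [RHS](@fubini_tonelli2 _ _ _ _ _ m12 m12).
Qed.

(** [leb4] is nested to the left, while [exchange_xy] acts on pairs of points of the plane; this
    reconciles the two groupings. *)
Lemma integral_prodA (F : (T1 * T2) * (T1 * T2) -> \bar R) :
  measurable_fun setT F -> (forall p, 0 <= F p)%E ->
  (\int[m12 \x m1 \x m2]_p F (p.1.1, (p.1.2, p.2)) = \int[m12 \x m12]_p F p)%E.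
Proof.
move=> mF F0; have mFa : measurable_fun setT
    (fun p : T1 * T2 * T1 * T2 => F (p.1.1, (p.1.2, p.2))).
  apply: (measurableT_comp mF); apply: measurable_fun_pair.
    exact: measurableT_comp.
  by apply: measurable_fun_pair => //; exact: measurableT_comp.
rewrite (@fubini_tonelli1 _ _ _ _ _ [the {sigma_finite_measure set _ -> \bar R}
  of prod_measure m12 m1] m2)//.
rewrite (@fubini_tonelli1 _ _ _ _ _ m12 m1); last 2 first.
- exact: measurable_fun_fubini_tonelli_F.
- by move=> z; exact: integral_ge0.
rewrite [RHS](@fubini_tonelli1 _ _ _ _ _ m12 m12)//.
apply: eq_integral => z _.
apply/esym/(@fubini_tonelli1 _ _ _ _ _ m1 m2 (fun q => F (z, q))) => //.
exact: (measurableT_comp mF (measurable_pair1 z)).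
Qed.

End coordinate_exchanges.

Lemma in_L2P d (T : measurableType d) (R : realType)
    (mu : {measure set T -> \bar R}) (f : T -> R) :
  f \in Lfun mu 2%:E <-> L2 mu f.
Proof.
split=> [Lf|[mf If]].
  split; last exact: Lfun2_integrable_sqr.
  by move: Lf; rewrite inE => /andP[+ _]; rewrite inE.
rewrite inE; apply/andP; split; rewrite inE//= /finite_norm unlock.
apply: poweR_lty; move/integrableP : If => [_]; apply: le_lt_trans.
rewrite le_eqVlt; apply/orP; left; apply/eqP; apply: eq_integral => x _ /=.
by rewrite powR_mulrn// normrX.
Qed.

Lemma L2_ae_eq d (T : measurableType d) (R : realType)
    (mu : {measure set T -> \bar R}) (f g : T -> R) :
  measurable_fun setT f -> L2 mu g -> {ae mu, forall z, f z = g z} -> L2 mu f.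
Proof.
move=> mf [mg Ig] fg; apply: L2P => //.
rewrite (@ae_eq_integral _ _ _ mu setT (fun z => (g z ^+ 2)%:E))//.
- by apply: integrable_lty.
- by apply/measurable_EFinP; exact: measurable_funX.
- by apply/measurable_EFinP; exact: measurable_funX.
by apply: filterS fg => z -> _.
Qed.

Section kernel_rows.
Context d d' (Z : measurableType d) (S : measurableType d') (R : realType).
Variables (mu : {sigma_finite_measure set Z -> \bar R}).
Variables (lam : {sigma_finite_measure set S -> \bar R}).
Local Notation mulam := (mu \x lam)%E.
Variable tau : Z * S -> Z * S.
Hypothesis tauP : measure_preserving_involution mu lam tau.
Variables (B : set (Z * S)) (beta : R).
Hypothesis beta0 : 0 <= beta.
Hypothesis mB : measurable B.
Hypothesis tauB : forall p, B p -> B (tau p).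
Hypothesis lamB : forall z, (lam (xsection B z) <= beta%:E)%E.
Variables (m : nat) (K : 'I_m -> Z * S -> R) (u : 'I_m -> Z -> R).
Hypothesis LK : forall j, L2 mulam (K j).
Hypothesis K0 : forall j p, ~ B p -> K j p = 0.
Hypothesis Lu : forall j, L2 mu (u j).

Lemma kernel_row_measurable :
  measurable_fun setT (fun p => \sum_(j < m) K j p * u j (tau p).1).
Proof.
have [mtau _ _] := tauP; apply: measurable_sum => j.
have [mK _] := LK j; have [mu' _] := Lu j.
by apply: measurable_funM => //; apply: (measurableT_comp mu'); exact: measurableT_comp.
Qed.

(** P[N] integrates a matrix-vector product, with the sum over j under the integral. Taking the sum
    out requires every summand to be integrable in s. *)
Lemma kernel_row_ae : {ae mu, forall z,
  lam.-integrable setT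
    (EFin \o (fun s => \sum_(j < m) K j (z, s) * u j (tau (z, s)).1)) /\
  \int[lam]_s (\sum_(j < m) K j (z, s) * u j (tau (z, s)).1) =
  \sum_(j < m) kernel_operator lam tau (K j) (u j) z}.
Proof.
have aeI : {ae mu, forall z, forall j : 'I_m, lam.-integrable setT
    (fun s => (K j (z, s) * u j (tau (z, s)).1)%:E)}.
  apply: filter_forall => j.
  exact: (kernel_ae_integrable tauP beta0 mB tauB lamB (LK j) (@K0 j) (Lu j)).
apply: filterS aeI => z Iz.
apply: (@Rintegral_sum _ _ _ lam _ (index_enum 'I_m) xpredT
  (fun j s => K j (z, s) * u j (tau (z, s)).1)) => j _.
exact: Iz.
Qed.

End kernel_rows.

Section iterated_integral.
Context d1 d2 (T1 : measurableType d1) (T2 : measurableType d2) (R : realType).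
Variables (m1 : {sigma_finite_measure set T1 -> \bar R}).
Variables (m2 : {sigma_finite_measure set T2 -> \bar R}).

(** The double integrals of [PI_op] are iterated, those of [xy_op] are over the product. *)
Lemma Rintegral_iterated (f : T1 * T2 -> R) :
  (prod_measure m1 m2).-integrable setT (EFin \o f) ->
  \int[m1]_x \int[m2]_y f (x, y) = \int[prod_measure m1 m2]_z f z.
Proof.
move=> If; have mf : measurable_fun setT f.
  by apply/measurable_EFinP; have /integrableP[] := If.
have [] := @Rintegral_fubini _ _ _ _ _ m1 m2 (fun=> 1) f.
- exact: measurable_cst.
- exact: mf.
- exact: (ae_integrable1 If).
- by under eq_fun do rewrite mul1r.
under eq_fun do rewrite mul1r.
by under [in RHS]eq_fun do rewrite mul1r.
Qed.

Lemma L2_prodA (g : T1 * T2 * T1 * T2 -> R) :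
  L2 (m1 \x m2 \x m1 \x m2)%E g <->
  L2 (prod_measure m1 m2 \x prod_measure m1 m2)%E
    (fun p => g (p.1, p.2.1, p.2.2)).
Proof.
pose a (p : (T1 * T2) * (T1 * T2)) := (p.1, p.2.1, p.2.2).
pose b (p : T1 * T2 * T1 * T2) := (p.1.1, (p.1.2, p.2)).
have ma : measurable_fun setT a.
  apply: measurable_fun_pair; last exact: measurableT_comp.
  by apply: measurable_fun_pair => //; exact: measurableT_comp.
have mb : measurable_fun setT b.
  apply: measurable_fun_pair; first exact: measurableT_comp.
  by apply: measurable_fun_pair => //; exact: measurableT_comp.
have gE : g = (g \o a) \o b by apply/funext => -[[[]]].
have intE : measurable_fun setT (g \o a) ->
  (\int[m1 \x m2 \x m1 \x m2]_p (g p ^+ 2)%:E =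
   \int[prod_measure m1 m2 \x prod_measure m1 m2]_p ((g \o a) p ^+ 2)%:E)%E.
  move=> mga.
  rewrite -(@integral_prodA _ _ _ _ _ m1 m2 (fun p => ((g \o a) p ^+ 2)%:E)).
  - by apply: eq_integral => -[[[]]].
  - by apply/measurable_EFinP; exact: measurable_funX.
  - by move=> p; rewrite lee_fin sqr_ge0.
split=> -[mg Ig].
  have mga : measurable_fun setT (g \o a) by exact: measurableT_comp.
  apply: L2P => //; rewrite -(intE mga); exact: (integrable_lty measurableT Ig).
have mga : measurable_fun setT (g \o a) by exact: mg.
have mg' : measurable_fun setT g by rewrite gE; exact: measurableT_comp.
by apply: L2P => //; rewrite (intE mga); exact: (integrable_lty measurableT Ig).
Qed.

End iterated_integral.

(** * The operator P[N] *)

Section operator_parts.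
Variable R : realType.
Variables a b c d : R.
Hypotheses (ab : a <= b) (cd : c <= d).

Local Notation leb := (@lebesgue_measure R).
Local Notation mu := (prod_measure leb leb).
Local Notation Z := (measurableTypeR R * measurableTypeR R)%type.

(** [true] stands for kernel index 1 (the variable of integration is below), [false] for index 2.
    Both cases contain the diagonal, so exchanging x and t turns one exactly into the other. *)
Definition side (s : bool) (x t : R) : bool := if s then t <= x else x <= t.

Definition Dx : set (Z * measurableTypeR R) := box a b c d `*` `[a, b].
Definition Dy : set (Z * measurableTypeR R) := box a b c d `*` `[c, d].
Definition Dxy : set (Z * Z) := box a b c d `*` box a b c d.

Definition x_region s : set (Z * measurableTypeR R) :=
  Dx `&` [set p | side s p.1.1 p.2].
Definition y_region s : set (Z * measurableTypeR R) :=
  Dy `&` [set p | side s p.1.2 p.2].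
Definition xy_region s s' : set (Z * Z) :=
  Dxy `&` ([set p | side s p.1.1 p.2.1] `&` [set p | side s' p.1.2 p.2.2]).

Lemma measurable_box : measurable (box a b c d : set Z).
Proof. by apply: measurableX; exact: measurable_itv. Qed.

Lemma measurable_Dx : measurable Dx.
Proof. by apply: measurableX; [exact: measurable_box|exact: measurable_itv]. Qed.

Lemma measurable_Dy : measurable Dy.
Proof. by apply: measurableX; [exact: measurable_box|exact: measurable_itv]. Qed.

Lemma measurable_Dxy : measurable Dxy.
Proof. by apply: measurableX; exact: measurable_box. Qed.

Lemma measurable_side e (T : measurableType e) (f g : T -> R) s :
  measurable_fun setT f -> measurable_fun setT g ->
  measurable [set p | side s (f p) (g p)].
Proof.
move=> mf mg; rewrite -[X in measurable X]setTI.
by case: s; exact: measurable_fun_le.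
Qed.

Lemma measurable_x_region s : measurable (x_region s).
Proof.
apply: measurableI; first exact: measurable_Dx.
by apply: measurable_side => //; exact: measurableT_comp.
Qed.

Lemma measurable_y_region s : measurable (y_region s).
Proof.
apply: measurableI; first exact: measurable_Dy.
by apply: measurable_side => //; exact: measurableT_comp.
Qed.

Lemma measurable_xy_region s s' : measurable (xy_region s s').
Proof.
apply: measurableI; first exact: measurable_Dxy.
by apply: measurableI; apply: measurable_side; exact: measurableT_comp.
Qed.

Lemma exchange_x_Dx p : Dx p -> Dx (exchange_x p).
Proof. by case: p => -[x y] t [[/= Hx Hy] Ht]. Qed.

Lemma exchange_y_Dy p : Dy p -> Dy (exchange_y p).
Proof. by case: p => -[x y] t [[/= Hx Hy] Ht]. Qed.

Lemma exchange_xy_Dxy p : Dxy p -> Dxy (exchange_xy p).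
Proof. by case: p => z z' [/= Hz Hz']. Qed.

Lemma lebesgue_measure_itv_le (l u : R) : l <= u ->
  (lebesgue_measure `[l, u] <= (u - l)%:E)%E.
Proof.
move=> lu; rewrite lebesgue_measure_itv/= lte_fin.
by case: ifP => // _; rewrite lee_fin subr_ge0.
Qed.

Lemma section_Dx z : (leb (xsection Dx z) <= (b - a)%:E)%E.
Proof.
apply: le_trans (lebesgue_measure_itv_le ab); apply: le_measure.
- by rewrite inE; apply: measurable_xsection; exact: measurable_Dx.
- by rewrite inE.
- by move=> t /xsectionP[].
Qed.

Lemma section_Dy z : (leb (xsection Dy z) <= (d - c)%:E)%E.
Proof.
apply: le_trans (lebesgue_measure_itv_le cd); apply: le_measure.
- by rewrite inE; apply: measurable_xsection; exact: measurable_Dy.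
- by rewrite inE.
- by move=> t /xsectionP[].
Qed.

Lemma section_Dxy z : (mu (xsection Dxy z) <= ((b - a) * (d - c))%:E)%E.
Proof.
apply: (@le_trans _ _ (mu (box a b c d))).
  apply: le_measure.
  - by rewrite inE; apply: measurable_xsection; exact: measurable_Dxy.
  - by rewrite inE; exact: measurable_box.
  - by move=> t /xsectionP[].
rewrite /prod_measure product_measure1E; [|exact: measurable_itv|exact: measurable_itv].
rewrite EFinM; apply: lee_pmul; rewrite ?measure_ge0//.
  exact: lebesgue_measure_itv_le.
exact: lebesgue_measure_itv_le.
Qed.

End operator_parts.

Section operator_kernels.
Variable R : realType.
Variables a b c d : R.
Hypotheses (ab : a <= b) (cd : c <= d).

Local Notation leb := (@lebesgue_measure R).
Local Notation mu := (prod_measure leb leb).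
Local Notation Z := (measurableTypeR R * measurableTypeR R)%type.
Local Notation exx := (@exchange_x _ _ (measurableTypeR R) (measurableTypeR R)).
Local Notation exy := (@exchange_y _ _ (measurableTypeR R) (measurableTypeR R)).
Local Notation exxy := (@exchange_xy _ _ (measurableTypeR R) (measurableTypeR R)).
Local Notation bx := (box a b c d).

Section entries.
Variables (n m : nat) (N : PIparam R n m) (i : 'I_n) (j : 'I_m).

Definition Nx (s : bool) := if s then N10 N else N20 N.
Definition Ny (s : bool) := if s then N01 N else N02 N.
Definition Nxy (s s' : bool) :=
  if s then (if s' then N11 N else N12 N) else (if s' then N21 N else N22 N).

Definition mul_kernel : Z -> R := (fun z => N00 N z i j) \_ bx.
(** The kernel is extended by 0 from its region of integration, so that the integral runs over the
    whole line and the limits are encoded in the kernel alone. *)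
Definition x_kernel s : Z * measurableTypeR R -> R :=
  (fun p => Nx s p i j) \_ (x_region a b c d s).
Definition y_kernel s : Z * measurableTypeR R -> R :=
  (fun p => Ny s p i j) \_ (y_region a b c d s).
Definition xy_kernel s s' : Z * Z -> R :=
  (fun p => Nxy s s' (p.1, p.2.1, p.2.2) i j) \_ (xy_region a b c d s s').

Definition x_op s := kernel_operator leb exx (x_kernel s).
Definition y_op s := kernel_operator leb exy (y_kernel s).
Definition xy_op s s' := kernel_operator mu exxy (xy_kernel s s').

(** Entry (i, j) of P[N] as a scalar operator; [PI_op_entries] relates the two. *)
Definition entry_op (u : Z -> R) (z : Z) : R :=
  mul_kernel z * u z + x_op true u z + x_op false u z
  + y_op true u z + y_op false u z
  + xy_op true true u z + xy_op false true u z
  + xy_op true false u z + xy_op false false u z.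

Hypothesis hN : in_N2D a b c d N.

Lemma L2_patchS e (T : measurableType e) (nu : {measure set T -> \bar R})
    (D E : set T) (f : T -> R) :
  measurable E -> E `<=` D -> L2 nu (f \_ D) -> L2 nu (f \_ E).
Proof.
move=> mE ED Lf; rewrite (_ : f \_ E = fun x => (f \_ D) x * \1_E x).
  exact: L2_indic.
apply/funext => x; rewrite !patchE indicE.
case: (boolP (x \in E)) => xE; last by rewrite mulr0.
by rewrite mulr1 mem_set//; apply: ED; rewrite inE in xE.
Qed.

Lemma L2_mul_kernel : L2 mu mul_kernel.
Proof. by have [+ _ _ _ _] := hN => /(_ i j)/in_L2P. Qed.

Lemma L2_x_kernel s : L2 (mu \x leb)%E (x_kernel s).
Proof.
apply: (@L2_patchS _ _ _ (Dx a b c d)).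
- exact: measurable_x_region.
- by move=> p [].
by have [_ _ [h1 h2] _ _] := hN; case: s; apply/in_L2P; [exact: h1|exact: h2].
Qed.

Lemma L2_y_kernel s : L2 (mu \x leb)%E (y_kernel s).
Proof.
apply: (@L2_patchS _ _ _ (Dy a b c d)).
- exact: measurable_y_region.
- by move=> p [].
by have [_ [h1 h2] _ _ _] := hN; case: s; apply/in_L2P; [exact: h1|exact: h2].
Qed.

Lemma L2_xy_kernel s s' : L2 (mu \x mu)%E (xy_kernel s s').
Proof.
apply: (@L2_patchS _ _ _ (Dxy a b c d)).
- exact: measurable_xy_region.
- by move=> p [].
(* The domain in the grouping of [leb4], in which [in_N2D] is stated. *)
pose D4 := bx `*` `[a, b] `*` `[c, d].
rewrite (_ : _ \_ _ = fun p => ((fun q => Nxy s s' q i j) \_ D4) (p.1, p.2.1, p.2.2)).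
  apply/(L2_prodA leb leb ((fun q => Nxy s s' q i j) \_ D4))/in_L2P.
  by have [_ _ _ [h1 h2] [h3 h4]] := hN; case: s; case: s';
    [exact: h1|exact: h2|exact: h3|exact: h4].
apply/funext => -[z [t s0]]; rewrite !patchE.
suff -> : ((z, (t, s0)) \in Dxy a b c d) = ((z, t, s0) \in D4) by [].
by apply/idP/idP; rewrite !inE => -[/=]; [move=> ? [] | move=> [? ?] ?].
Qed.

Lemma x_kernel_out s p : ~ Dx a b c d p -> x_kernel s p = 0.
Proof. by move=> pD; rewrite /x_kernel patchE memNset// => -[]. Qed.

Lemma y_kernel_out s p : ~ Dy a b c d p -> y_kernel s p = 0.
Proof. by move=> pD; rewrite /y_kernel patchE memNset// => -[]. Qed.

Lemma xy_kernel_out s s' p : ~ Dxy a b c d p -> xy_kernel s s' p = 0.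
Proof. by move=> pD; rewrite /xy_kernel patchE memNset// => -[]. Qed.

Lemma x_op_adjoint_pair s : adjoint_pair mu (x_op s)
  (kernel_operator leb exx (x_kernel s \o exx)).
Proof.
apply: (kernel_adjoint_pair (exchange_xP _ _) _ (measurable_Dx _ _ _ _)
  (@exchange_x_Dx _ _ _ _ _) (section_Dx _ _ ab)).
- by rewrite subr_ge0.
- exact: L2_x_kernel.
- exact: x_kernel_out.
Qed.


Lemma y_op_adjoint_pair s : adjoint_pair mu (y_op s)
  (kernel_operator leb exy (y_kernel s \o exy)).
Proof.
apply: (kernel_adjoint_pair (exchange_yP _ _) _ (measurable_Dy _ _ _ _)
  (@exchange_y_Dy _ _ _ _ _) (section_Dy _ _ cd)).
- by rewrite subr_ge0.
- exact: L2_y_kernel.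
- exact: y_kernel_out.
Qed.

Lemma xy_op_adjoint_pair s s' : adjoint_pair mu (xy_op s s')
  (kernel_operator mu exxy (xy_kernel s s' \o exxy)).
Proof.
apply: (kernel_adjoint_pair (exchange_xyP _ _) _ (measurable_Dxy _ _ _ _)
  (@exchange_xy_Dxy _ _ _ _ _) (section_Dxy ab cd)).
- by rewrite mulr_ge0// subr_ge0.
- exact: L2_xy_kernel.
- exact: xy_kernel_out.
Qed.

End entries.

Section adjoint_entries.
Variables (n m : nat) (N : PIparam R n m) (i : 'I_n) (j : 'I_m).

Lemma mul_kernel_adj : mul_kernel (PIadj N) j i = mul_kernel N i j.
Proof. by apply/funext => -[x y]; rewrite /mul_kernel !patchE /= mxE. Qed.

(** Exchanging x and theta reverses theta <= x; this is why indices 1 and 2 trade places in the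
    adjoint parameter. *)
Lemma x_kernel_adj s : x_kernel (PIadj N) j i s = x_kernel N i j (~~ s) \o exx.
Proof.
apply/funext => -[[x y] t]; rewrite /x_kernel /= !patchE /exchange_x /=.
have -> : ((x, y, t) \in x_region a b c d s) = ((t, y, x) \in x_region a b c d (~~ s)).
  by apply/idP/idP; rewrite !inE => -[/exchange_x_Dx]; case: s.
by case: s; rewrite /= mxE.
Qed.

Lemma y_kernel_adj s : y_kernel (PIadj N) j i s = y_kernel N i j (~~ s) \o exy.
Proof.
apply/funext => -[[x y] t]; rewrite /y_kernel /= !patchE /exchange_y /=.
have -> : ((x, y, t) \in y_region a b c d s) = ((x, t, y) \in y_region a b c d (~~ s)).
  by apply/idP/idP; rewrite !inE => -[/exchange_y_Dy]; case: s.
by case: s; rewrite /= mxE.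
Qed.

Lemma xy_kernel_adj s s' :
  xy_kernel (PIadj N) j i s s' = xy_kernel N i j (~~ s) (~~ s') \o exxy.
Proof.
apply/funext => -[[x y] [t w]]; rewrite /xy_kernel /= !patchE /exchange_xy /=.
have -> : ((x, y, (t, w)) \in xy_region a b c d s s') =
    ((t, w, (x, y)) \in xy_region a b c d (~~ s) (~~ s')).
  by apply/idP/idP; rewrite !inE => -[/exchange_xy_Dxy]; case: s; case: s'.
by case: s; case: s'; rewrite /= mxE.
Qed.

Lemma entry_op_adjoint_pair : in_N2D a b c d N ->
  adjoint_pair mu (entry_op N i j) (entry_op (PIadj N) j i).
Proof.
move=> hN.
(* The terms are reordered so that each stands opposite the term of N whose adjoint it is, with
   every side negated. *)
have -> : entry_op (PIadj N) j i = fun v z => mul_kernel N i j z * v z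
  + x_op (PIadj N) j i false v z + x_op (PIadj N) j i true v z
  + y_op (PIadj N) j i false v z + y_op (PIadj N) j i true v z
  + xy_op (PIadj N) j i false false v z + xy_op (PIadj N) j i true false v z
  + xy_op (PIadj N) j i false true v z + xy_op (PIadj N) j i true true v z.
  by apply/funext => v; apply/funext => z; rewrite /entry_op mul_kernel_adj; ring.
do 4 (apply: adjoint_pairD; last by rewrite /xy_op xy_kernel_adj; exact: xy_op_adjoint_pair).
do 2 (apply: adjoint_pairD; last by rewrite /y_op y_kernel_adj; exact: y_op_adjoint_pair).
do 2 (apply: adjoint_pairD; last by rewrite /x_op x_kernel_adj; exact: x_op_adjoint_pair).
by apply: multiplication_adjoint_pair; exact: L2_mul_kernel.
Qed.

(** With this, [entry_op_adjoint_pair] for the adjoint parameter supplies the pair in the reverse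
    direction. *)
Lemma PIadjK : PIadj (PIadj N) = N.
Proof.
by case: N => *; rewrite /PIadj /=; congr MkPIparam; apply/funext;
  [move=> [x y]|move=> [[x y] s]|move=> [[x y] s]|move=> [[x y] s]
  |move=> [[[x y] t] s]|move=> [[[x y] t] s]|move=> [[x y] s]
  |move=> [[[x y] t] s]|move=> [[[x y] t] s]]; rewrite trmxK.
Qed.

End adjoint_entries.

Lemma in_L2_transpose e e' (U : measurableType e) (S : measurableType e')
    (nu : {sigma_finite_measure set U -> \bar R})
    (lam : {sigma_finite_measure set S -> \bar R}) (tau : U * S -> U * S)
    (D : set (U * S)) n m (f : U * S -> 'M[R]_(n, m)) (g : U * S -> 'M[R]_(m, n)) :
  measure_preserving_involution nu lam tau -> (forall p, D p -> D (tau p)) ->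
  (forall p, g p = (f (tau p))^T) ->
  in_L2 (nu \x lam)%E D f -> in_L2 (nu \x lam)%E D g.
Proof.
move=> tauP tauD gE Lf j i; apply/in_L2P.
have := L2_involution tauP ((in_L2P _ _).1 (Lf i j)).
congr (L2 _ _); apply/funext => p; rewrite /= !patchE gE mxE.
have [_ tauK _] := tauP.
suff -> : (tau p \in D) = (p \in D) by [].
by apply/idP/idP; rewrite !inE => /tauD //; rewrite tauK.
Qed.

Lemma in_N2D_PIadj n m (N : PIparam R n m) :
  in_N2D a b c d N -> in_N2D a b c d (PIadj N).
Proof.
move=> [h0 [h1 h2] [h3 h4] [h5 h6] [h7 h8]].
have tr1 (f : Z * measurableTypeR R -> 'M[R]_(n, m)) :
    in_L2 (leb3 R) (Dx a b c d) f ->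
    in_L2 (leb3 R) (Dx a b c d) (fun '(x, y, t) => (f (t, y, x))^T).
  apply: (in_L2_transpose (exchange_xP leb leb)); first exact: exchange_x_Dx.
  by case=> -[x y] t.
have tr2 (f : Z * measurableTypeR R -> 'M[R]_(n, m)) :
    in_L2 (leb3 R) (Dy a b c d) f ->
    in_L2 (leb3 R) (Dy a b c d) (fun '(x, y, s) => (f (x, s, y))^T).
  apply: (in_L2_transpose (exchange_yP leb leb)); first exact: exchange_y_Dy.
  by case=> -[x y] t.
have tr3 (f : Z * measurableTypeR R * measurableTypeR R -> 'M[R]_(n, m)) :
    in_L2 (leb4 R) (Dx a b c d `*` `[c, d]) f ->
    in_L2 (leb4 R) (Dx a b c d `*` `[c, d])
      (fun '(x, y, t, s) => (f (t, s, x, y))^T).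
  move=> Lf j i; apply/in_L2P/(L2_prodA leb leb).
  have /in_L2P/(L2_prodA leb leb) := Lf i j.
  move/(L2_involution (exchange_xyP leb leb)).
  congr (L2 _ _); apply/funext => -[[x y] [t s]]; rewrite /= !patchE /= mxE.
  suff -> : ((t, s, x, y) \in Dx a b c d `*` `[c, d]) =
    ((x, y, t, s) \in Dx a b c d `*` `[c, d]) by [].
  by apply/idP/idP; rewrite !inE => -[[[/= ? ?] ?] ?].
split; [|split|split|split|split].
- move=> j i; apply/in_L2P; have /in_L2P := h0 i j.
  by congr (L2 _ _); apply/funext => -[x y]; rewrite !patchE /= mxE.
- exact: (tr2 _ h2).
- exact: (tr2 _ h1).
- exact: (tr1 _ h4).
- exact: (tr1 _ h3).
- exact: (tr3 _ h8).
- exact: (tr3 _ h7).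
- exact: (tr3 _ h6).
- exact: (tr3 _ h5).
Qed.

End operator_kernels.

(** * Components of P[N]u as integrals over the whole line or plane *)

Section operator_rows.
Variable R : realType.
Variables a b c d : R.
Hypotheses (ab : a <= b) (cd : c <= d).

Local Notation leb := (@lebesgue_measure R).
Local Notation mu := (prod_measure leb leb).
Local Notation Z := (measurableTypeR R * measurableTypeR R)%type.
Local Notation exx := (@exchange_x _ _ (measurableTypeR R) (measurableTypeR R)).
Local Notation exy := (@exchange_y _ _ (measurableTypeR R) (measurableTypeR R)).
Local Notation exxy := (@exchange_xy _ _ (measurableTypeR R) (measurableTypeR R)).
Local Notation bx := (box a b c d).

Section rows.
Variables (n m : nat) (N : PIparam R n m) (hN : in_N2D a b c d N).
Variables (u : R * R -> 'cV[R]_m) (Lu : L2_box a b c d u) (i : 'I_n).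

Definition component j : Z -> R := (fun z => u z j 0) \_ bx.

Lemma L2_component j : L2 mu (component j).
Proof. by have /in_L2P := Lu j 0. Qed.

(** Rows keep the sum over j under the integrals, as P[N] does. They therefore agree with P[N]u at
    every point of the box, which gives its measurability, and with the sums of entries almost
    everywhere. *)
Definition mul_row z := \sum_(j < m) mul_kernel a b c d N i j z * component j z.
Definition x_row s z := \int[leb]_t
  (\sum_(j < m) x_kernel a b c d N i j s (z, t) * component j (exx (z, t)).1).
Definition y_row s z := \int[leb]_w
  (\sum_(j < m) y_kernel a b c d N i j s (z, w) * component j (exy (z, w)).1).
Definition xy_row s s' z := \int[leb]_t \int[leb]_w
  (\sum_(j < m) xy_kernel a b c d N i j s s' (z, (t, w)) *
     component j (exxy (z, (t, w))).1).

Definition side_itv (s : bool) (l r x : R) : set R :=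
  if s then `[l, x]%classic else `[x, r]%classic.

Lemma side_itvE s l r x t : l <= x <= r ->
  side_itv s l r x t = (t \in `[l, r]) && side s x t :> Prop.
Proof.
move=> /andP[lx xr]; apply/propext; rewrite /side_itv /side !in_itv/=.
case: s; rewrite /= in_itv/=; split.
- by move=> /andP[lt tx]; rewrite lt tx (le_trans tx xr).
- by move=> /andP[/andP[-> _] ->].
- by move=> /andP[xt tr]; rewrite xt tr (le_trans lx xt).
- by move=> /andP[/andP[_ ->] ->].
Qed.

Lemma vint_x_row s x y : bx (x, y) ->
  vint (side_itv s a b x) (fun t => Nx N s (x, y, t) *m u (t, y)) i 0 =
  x_row s (x, y).
Proof.
move=> [/= xab ycd]; rewrite mxE Rintegral_mkcond; apply: eq_Rintegral => t _.
have reg : (t \in side_itv s a b x) = ((x, y, t) \in x_region a b c d s).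
  apply/idP/idP; rewrite !inE side_itvE//.
    by move=> /andP[tab st]; split.
  by move=> [[_ tab] st]; apply/andP.
rewrite patchE reg; case: ifPn => tin; last first.
  by rewrite big1// => j _; rewrite /x_kernel patchE (negbTE tin) mul0r.
rewrite mxE; apply: eq_bigr => j _; rewrite /x_kernel /component !patchE tin /=.
by rewrite mem_set//; split => //=; move: tin; rewrite inE => -[[_ ?] _].
Qed.

Lemma vint_y_row s x y : bx (x, y) ->
  vint (side_itv s c d y) (fun w => Ny N s (x, y, w) *m u (x, w)) i 0 =
  y_row s (x, y).
Proof.
move=> [/= xab ycd]; rewrite mxE Rintegral_mkcond; apply: eq_Rintegral => t _.
have reg : (t \in side_itv s c d y) = ((x, y, t) \in y_region a b c d s).
  apply/idP/idP; rewrite !inE side_itvE//.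
    by move=> /andP[tab st]; split.
  by move=> [[_ tab] st]; apply/andP.
rewrite patchE reg; case: ifPn => tin; last first.
  by rewrite big1// => j _; rewrite /y_kernel patchE (negbTE tin) mul0r.
rewrite mxE; apply: eq_bigr => j _; rewrite /y_kernel /component !patchE tin /=.
by rewrite mem_set//; split => //=; move: tin; rewrite inE => -[[_ ?] _].
Qed.

Lemma vint_xy_row s s' x y : bx (x, y) ->
  vint (side_itv s a b x) (fun t => vint (side_itv s' c d y)
    (fun w => Nxy N s s' (x, y, t, w) *m u (t, w))) i 0 =
  xy_row s s' (x, y).
Proof.
move=> [/= xab ycd]; rewrite mxE Rintegral_mkcond; apply: eq_Rintegral => t _.
have reg w : (t \in side_itv s a b x) && (w \in side_itv s' c d y) =
    ((x, y, (t, w)) \in xy_region a b c d s s').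
  apply/idP/idP; rewrite !inE; last first.
    move=> [[_ [/= tab wcd]] [/= st sw]].
    by apply/andP; rewrite !inE !side_itvE//; split; apply/andP.
  move=> /andP[]; rewrite !inE !side_itvE// => /andP[tab st] /andP[wcd sw].
  by split.
rewrite patchE; case: ifPn => tin; last first.
  (* For t outside its interval the patched outer integrand is 0, which must be matched with an
     inner integral of zeros. *)
  transitivity (\int[leb]_w (0 : R)); first by rewrite Rintegral_cst// mul0r.
  apply: eq_Rintegral => w _; apply/esym; rewrite big1// => j _.
  by rewrite /xy_kernel patchE -reg (negbTE tin) mul0r.
rewrite mxE Rintegral_mkcond; apply: eq_Rintegral => w _.
rewrite patchE; have := reg w; rewrite tin /= => ->; case: ifPn => win; last first.
  by rewrite big1// => j _; rewrite /xy_kernel patchE (negbTE win) mul0r.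
rewrite mxE; apply: eq_bigr => j _; rewrite /xy_kernel /component !patchE win /=.
by rewrite mem_set//; move: win; rewrite inE => -[[]].
Qed.

Definition rows z := mul_row z + x_row true z + x_row false z
  + y_row true z + y_row false z
  + xy_row true true z + xy_row false true z
  + xy_row true false z + xy_row false false z.

Lemma PI_op_rows z : bx z -> PI_op a b c d N u z i 0 = rows z.
Proof.
case: z => x y zb; have addE (A B : 'cV[R]_n) : (A + B) i 0 = A i 0 + B i 0.
  by rewrite mxE.
rewrite /PI_op !addE /rows -!vint_x_row// -!vint_y_row// -!vint_xy_row//.
do 8 congr (_ + _).
rewrite mxE; apply: eq_bigr => j _; rewrite /mul_kernel /component !patchE.
by rewrite mem_set.
Qed.

Lemma mul_row_measurable : measurable_fun setT mul_row.
Proof.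
apply: measurable_sum => j; apply: measurable_funM.
  by have [] := L2_mul_kernel i j hN.
by have [] := L2_component j.
Qed.

Lemma x_row_measurable s : measurable_fun setT (x_row s).
Proof.
apply: (measurable_Rintegral leb (f := fun p : Z * measurableTypeR R =>
  \sum_(j < m) x_kernel a b c d N i j s p * component j (exx p).1)).
apply: (kernel_row_measurable (exchange_xP leb leb)) => j.
  exact: L2_x_kernel.
exact: L2_component.
Qed.

Lemma y_row_measurable s : measurable_fun setT (y_row s).
Proof.
apply: (measurable_Rintegral leb (f := fun p : Z * measurableTypeR R =>
  \sum_(j < m) y_kernel a b c d N i j s p * component j (exy p).1)).
apply: (kernel_row_measurable (exchange_yP leb leb)) => j.
  exact: L2_y_kernel.
exact: L2_component.
Qed.

Lemma xy_row_measurable s s' : measurable_fun setT (xy_row s s').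
Proof.
pose f (p : Z * Z) :=
  \sum_(j < m) xy_kernel a b c d N i j s s' p * component j (exxy p).1.
have mf : measurable_fun setT f.
  apply: (kernel_row_measurable (exchange_xyP leb leb)) => j.
    exact: L2_xy_kernel.
  exact: L2_component.
apply: (measurable_Rintegral leb (f := fun p : Z * measurableTypeR R =>
  \int[leb]_w f (p.1, (p.2, w)))).
apply: (measurable_Rintegral leb
  (f := fun p : Z * measurableTypeR R * measurableTypeR R =>
  f (p.1.1, (p.1.2, p.2)))).
apply: (measurableT_comp mf); apply: measurable_fun_pair; first exact: measurableT_comp.
by apply: measurable_fun_pair => //; exact: measurableT_comp.
Qed.

Lemma x_row_ae s : {ae mu, forall z,
  x_row s z = \sum_(j < m) x_op a b c d N i j s (component j) z}.
Proof.
have := kernel_row_ae (exchange_xP leb leb) _ (measurable_Dx a b c d)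
  (@exchange_x_Dx _ a b c d) (section_Dx c d ab) (fun j => L2_x_kernel i j hN s)
  (fun j => x_kernel_out N i j s) L2_component.
by rewrite subr_ge0 => /(_ ab); apply: filterS => z [].
Qed.

Lemma y_row_ae s : {ae mu, forall z,
  y_row s z = \sum_(j < m) y_op a b c d N i j s (component j) z}.
Proof.
have := kernel_row_ae (exchange_yP leb leb) _ (measurable_Dy a b c d)
  (@exchange_y_Dy _ a b c d) (section_Dy a b cd) (fun j => L2_y_kernel i j hN s)
  (fun j => y_kernel_out N i j s) L2_component.
by rewrite subr_ge0 => /(_ cd); apply: filterS => z [].
Qed.

Lemma xy_row_ae s s' : {ae mu, forall z,
  xy_row s s' z = \sum_(j < m) xy_op a b c d N i j s s' (component j) z}.
Proof.
have := kernel_row_ae (exchange_xyP leb leb) _ (measurable_Dxy a b c d)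
  (@exchange_xy_Dxy _ a b c d) (section_Dxy ab cd) (fun j => L2_xy_kernel i j hN s s')
  (fun j => xy_kernel_out N i j s s') L2_component.
rewrite mulr_ge0 ?subr_ge0// => /(_ isT); apply: filterS => z [Iz <-].
exact: (Rintegral_iterated Iz).
Qed.

End rows.
End operator_rows.

(** * From scalar entries to the matrix operator *)

Section operator_adjoint.
Variable R : realType.
Variables a b c d : R.
Hypotheses (ab : a <= b) (cd : c <= d).

Local Notation leb := (@lebesgue_measure R).
Local Notation mu := (prod_measure leb leb).
Local Notation Z := (measurableTypeR R * measurableTypeR R)%type.
Local Notation bx := (box a b c d).

Section single.
Variables (n m : nat) (N : PIparam R n m) (hN : in_N2D a b c d N).

Lemma kernel_operator_eq0 e (S : measurableType e)
    (lam : {sigma_finite_measure set S -> \bar R})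
    (tau : Z * S -> Z * S) (K : Z * S -> R) g z :
  (forall s, K (z, s) * g (tau (z, s)).1 = 0) -> kernel_operator lam tau K g z = 0.
Proof.
move=> Kg; rewrite /kernel_operator (_ : (fun s => _) = fun=> 0); last exact/funext.
by rewrite Rintegral_cst// mul0r.
Qed.

Lemma entry_op_out i j g z : ~ bx z -> entry_op a b c d N i j g z = 0.
Proof.
move=> zb; rewrite /entry_op /mul_kernel patchE memNset// mul0r.
rewrite /x_op /y_op /xy_op !kernel_operator_eq0 ?addr0// => s.
all: by rewrite ?(x_kernel_out, y_kernel_out, xy_kernel_out) ?mul0r// => -[].
Qed.

Lemma entry_op0 i j z : entry_op a b c d N i j (fun=> 0) z = 0.
Proof.
rewrite /entry_op mulr0 /x_op /y_op /xy_op !kernel_operator_eq0 ?addr0// => s.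
all: by rewrite mulr0.
Qed.

Lemma kernel_operator_restr e (S : measurableType e)
    (lam : {sigma_finite_measure set S -> \bar R})
    (tau : Z * S -> Z * S) (K : Z * S -> R) (D : set (Z * S)) g z :
  (forall p, ~ D p -> K p = 0) -> (forall p, D p -> bx (tau p).1) ->
  kernel_operator lam tau K (g \_ bx) z = kernel_operator lam tau K g z.
Proof.
move=> K0 Dbx; apply: eq_Rintegral => s _.
have [/Dbx zsb|/K0->] := pselect (D (z, s)); last by rewrite !mul0r.
by rewrite patchE mem_set.
Qed.

(** Every kernel vanishes unless the point at which g is evaluated lies in the box. *)
Lemma entry_op_restr i j g z :
  entry_op a b c d N i j (g \_ bx) z = entry_op a b c d N i j g z.
Proof.
have e1 s : x_op a b c d N i j s (g \_ bx) z = x_op a b c d N i j s g z.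
  by apply: kernel_operator_restr; [exact: x_kernel_out|move=> p /exchange_x_Dx[]].
have e2 s : y_op a b c d N i j s (g \_ bx) z = y_op a b c d N i j s g z.
  by apply: kernel_operator_restr; [exact: y_kernel_out|move=> p /exchange_y_Dy[]].
have e3 s s' : xy_op a b c d N i j s s' (g \_ bx) z = xy_op a b c d N i j s s' g z.
  by apply: kernel_operator_restr; [exact: xy_kernel_out|move=> p /exchange_xy_Dxy[]].
rewrite /entry_op !e1 !e2 !e3.
do 8 congr (_ + _).
by rewrite /mul_kernel !patchE; case: ifP; rewrite ?mul0r.
Qed.

Lemma PI_op_measurable u i : L2_box a b c d u ->
  measurable_fun setT ((fun z => PI_op a b c d N u z i 0) \_ bx : Z -> R).
Proof.
move=> Lu; rewrite (_ : _ \_ _ = fun z => rows a b c d N u i z * \1_bx z).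
  apply: measurable_funM; last by apply: measurable_indic; exact: measurable_box.
  rewrite /rows; do ! apply: measurable_funD.
  - exact: mul_row_measurable.
  - exact: x_row_measurable.
  - exact: x_row_measurable.
  - exact: y_row_measurable.
  - exact: y_row_measurable.
  - exact: xy_row_measurable.
  - exact: xy_row_measurable.
  - exact: xy_row_measurable.
  - exact: xy_row_measurable.
apply/funext => z; rewrite patchE indicE; case: ifPn => zb; last by rewrite mulr0.
by rewrite mulr1 PI_op_rows//; rewrite inE in zb.
Qed.

Lemma PI_op_entries u i : L2_box a b c d u -> {ae mu, forall z : Z,
  ((fun z => PI_op a b c d N u z i 0) \_ bx) z =
  \sum_(j < m) entry_op a b c d N i j (component a b c d u j) z}.
Proof.
move=> Lu.
have a1 := x_row_ae ab hN Lu i; have a2 := y_row_ae cd hN Lu i.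
have a3 := xy_row_ae ab cd hN Lu i.
apply: filterS3 (filterI (a1 true) (a1 false)) (filterI (a2 true) (a2 false))
  (filterI (filterI (a3 true true) (a3 false true))
    (filterI (a3 true false) (a3 false false))).
move=> z [e1 e1'] [e2 e2'] [[e3 e3'] [e4 e4']]; rewrite patchE.
case: ifPn => zb; last first.
  by rewrite big1// => j _; apply: entry_op_out => zb'; rewrite mem_set in zb.
rewrite PI_op_rows; last by rewrite inE in zb.
by rewrite /rows e1 e1' e2 e2' e3 e3' e4 e4' /mul_row -!big_split.
Qed.

(** The vector with g in component j and 0 elsewhere isolates entry (i, j) in component i of P[N]u,
    so the mapping property of P[N] passes to each entry. *)
Lemma entry_op_L2 i j g : PI_op_L2 a b c d N -> L2 mu g ->
  L2 mu (entry_op a b c d N i j g).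
Proof.
move=> hP Lg; have [mE _ _] := entry_op_adjoint_pair ab cd i j hN.
pose u (z : R * R) : 'cV[R]_m := \col_k (if k == j then g z else 0).
have uE k : component a b c d u k = if k == j then g \_ bx else fun=> 0.
  apply/funext => z; rewrite /component patchE mxE.
  by case: (k == j); rewrite ?patchE; case: ifP.
have Lgb : L2 mu (g \_ bx).
  rewrite (_ : g \_ bx = fun z => g z * \1_bx z).
    by apply: L2_indic => //; exact: measurable_box.
  by apply/funext => z; rewrite patchE indicE; case: ifP; rewrite ?mulr1 ?mulr0.
have Lu : L2_box a b c d u.
  move=> k i0; apply/in_L2P; rewrite ord1.
  have := uE k; rewrite /component => ->; case: (k == j) => //; exact: L2_0.
have /in_L2P LP := hP u Lu i 0.
apply: (L2_ae_eq (mE g Lg) LP).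
apply: filterS (PI_op_entries i Lu) => z ->.
rewrite (bigD1 j)//= big1 ?addr0; last first.
  by move=> k kj; rewrite uE (negbTE kj) entry_op0.
by rewrite uE eqxx entry_op_restr.
Qed.

Lemma inner_L2_component k (u v : R * R -> 'cV[R]_k) :
  L2_box a b c d u -> L2_box a b c d v ->
  inner_L2 a b c d u v = \sum_(i < k)
    \int[mu]_z (component a b c d u i z * component a b c d v i z).
Proof.
move=> Lu Lv; rewrite /inner_L2 Rintegral_mkcond.
have [_ <-] := @Rintegral_sum _ _ _ mu _ (index_enum 'I_k) xpredT
  (fun i z => component a b c d u i z * component a b c d v i z)
  (fun i _ => L2_mul (L2_component Lu i) (L2_component Lv i)).
apply: eq_Rintegral => z _; rewrite /component patchE.
by case: ifPn => zb; [apply: eq_bigr|rewrite big1] => // i _;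
  rewrite !patchE ?(negbTE zb) ?zb ?mul0r.
Qed.

Lemma inner_PI_op u v : PI_op_L2 a b c d N -> L2_box a b c d u -> L2_box a b c d v ->
  inner_L2 a b c d v (PI_op a b c d N u) =
  \sum_(i < n) \sum_(j < m) \int[mu]_z
    (component a b c d v i z * entry_op a b c d N i j (component a b c d u j) z).
Proof.
move=> hP Lu Lv; rewrite inner_L2_component//; last exact: hP.
apply: eq_bigr => i _.
have Le j := entry_op_L2 i j hP (L2_component Lu j).
have [_ <-] := @Rintegral_sum _ _ _ mu _ (index_enum 'I_m) xpredT
  (fun j z => component a b c d v i z * entry_op a b c d N i j (component a b c d u j) z)
  (fun j _ => L2_mul (L2_component Lv i) (Le j)).
apply: Rintegral_ae_eq.
- apply: measurable_funM; first by have [] := L2_component Lv i.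
  exact: PI_op_measurable.
- apply: measurable_sum => j; apply: measurable_funM.
    by have [] := L2_component Lv i.
  by have [] := Le j.
by apply: filterS (PI_op_entries i Lu) => z; rewrite /component => ->; rewrite mulr_sumr.
Qed.

End single.

Lemma PI_op_L2_adj n m (N : PIparam R n m) : in_N2D a b c d N ->
  PI_op_L2 a b c d N -> PI_op_L2 a b c d (PIadj N).
Proof.
move=> hN hP v Lv j i0; rewrite ord1; apply/in_L2P.
have hN' := in_N2D_PIadj hN.
apply: (L2_ae_eq (PI_op_measurable hN' j Lv) _ (PI_op_entries hN' j Lv)).
(* Square integrability of the adjoint is obtained entry by entry from [L2_adjoint], with both
   truncated pairs at hand. *)
apply: L2_sum => i _; have := entry_op_adjoint_pair ab cd j i hN'.
rewrite PIadjK => A'A; apply: (L2_adjoint (entry_op_adjoint_pair ab cd i j hN) A'A); last exact: L2_component.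
by move=> g; exact: entry_op_L2.
Qed.

End operator_adjoint.

Theorem lemma8 (R : realType) (a b c d : R) (n m : nat) (N : PIparam R n m)
  (hab : a < b) (hcd : c < d)
  (hN : in_N2D a b c d N) (hP : PI_op_L2 a b c d N) :
  [/\ in_N2D a b c d (PIadj N),
      PI_op_L2 a b c d (PIadj N) &
      forall (u : R * R -> 'cV[R]_m) (v : R * R -> 'cV[R]_n),
        L2_box a b c d u -> L2_box a b c d v ->
        inner_L2 a b c d v (PI_op a b c d N u)
        = inner_L2 a b c d (PI_op a b c d (PIadj N) v) u].
Proof.
have ab := ltW hab; have cd := ltW hcd.
have hN' := in_N2D_PIadj hN; have hP' := PI_op_L2_adj ab cd hN hP.
split => // u v Lu Lv; rewrite inner_PI_op//.
(* By symmetry of the inner product the adjoint side also has the form that [inner_PI_op]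
   expands. *)
have -> : inner_L2 a b c d (PI_op a b c d (PIadj N) v) u =
    inner_L2 a b c d u (PI_op a b c d (PIadj N) v).
  apply: eq_Rintegral => z _; apply: eq_bigr => i _; exact: mulrC.
rewrite inner_PI_op// exchange_big; apply: eq_bigr => j _; apply: eq_bigr => i _.
have := entry_op_adjoint_pair ab cd j i hN'; rewrite PIadjK => A'A.
rewrite (adjoint_identity (entry_op_adjoint_pair ab cd i j hN) A'A).
- by apply: eq_Rintegral => z _; rewrite mulrC.
- by move=> g; exact: entry_op_L2.
- exact: L2_component.
- exact: L2_component.
Qed.
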